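(* Let $p$ be a prime number, let $G=G'\times\langle\sigma\rangle$ be a finite group and let $K$ be a field. Assume that the following four properties hold: (i) either $\operatorname{char}K=0$, or $\operatorname{char}K=l>0$ and $G$ contains no non-trivial normal $l$-subgroup; (ii) $\operatorname{ord}(\sigma)=p$; (iii) $\zeta_p\in K$; (iv) for any prime factor $p'$ of $|Z(G')|$ with $p'\neq p$, one has $\zeta_{p'}\notin K$. Then $\operatorname{ed}_K(G)=\operatorname{ed}_K(G')+1$.
   Context: $Z(G')$ is the center of $G'$ and $\operatorname{ord}(\sigma)$ is the order of $\sigma$. $\zeta_m$ denotes a primitive $m$-th root of unity; writing $\zeta_m\in K$ means that $K$ contains a primitive $m$-th root of unity and tacitly includes $\operatorname{char}K\nmid m$ (where $\operatorname{char}K\nmid m$ means $\operatorname{char}K=0$, or $\operatorname{char}K>0$ does not divide $m$). All fields are assumed to contain the ground field $K$. Let $L/L_0$ be a finite separable extension of fields containing $K$. For an intermediate field $K\subset E_0\subset L_0$, one says that $L/L_0$ is defined over $E_0$ if there is a field $E$ with $E_0\subset E\subset L$, $[E:E_0]=[L:L_0]$ and $L=EL_0$. The essential dimension $\operatorname{ed}_K(L/L_0)$ is the minimum of $\operatorname{trdeg}_K E_0$ (transcendence degree over $K$), where $E_0$ runs over all such fields over which $L/L_0$ is defined. For a finite group $G$, define $\operatorname{ed}_K(G)=\operatorname{ed}_K(K(V)/K(V)^G)$, where $G\to GL(V)$ is a faithful finite-dimensional representation over $K$, $K(V)=K(x_1,\ldots,x_n)$ is the rational function field in a basis $x_1,\ldots,x_n$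 of the dual space of $V$ with the induced $G$-action, and $K(V)^G$ is the fixed field; this does not depend on the choice of the faithful representation. *)

(* Defs.v *)
From HB Require Import structures.
From mathcomp Require Import all_boot all_order all_algebra all_fingroup.
From mathcomp Require Import all_solvable all_character.
From mathcomp Require Import generic_quotient fraction.
From mathcomp Require Import mpoly.

Set Implicit Arguments.
Unset Strict Implicit.
Unset Printing Implicit Defensive.

Import GRing.Theory.
Local Open Scope ring_scope.
Local Open Scope quotient_scope.

(* A subfield of L is a predicate E : {pred L} with divring_closed E.         *)
(* Predicates are boolean, but under the classical axioms (excluded middle in *)
(* Type) these are all the subfields of L.                                    *)
Section EssentialDimension.

Variables (K L : fieldType) (iota : {rmorphism K -> L}).

Definition contains_ground (E : {pred L}) := forall a : K, iota a \in E.

Definition is_basis (E0 E : {pred L}) m (b : 'I_m -> L) :=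
  (forall i, b i \in E) /\
  (forall x, x \in E -> exists! c : {ffun 'I_m -> L},
     (forall i, c i \in E0) /\ x = \sum_(i < m) c i * b i).

Definition has_degree (E0 E : {pred L}) m := exists b : 'I_m -> L, is_basis E0 E b.

(* L is the compositum E F, the least subfield containing E and F. *)
Definition compositum_full (E F : {pred L}) :=
  forall M : {pred L}, divring_closed M ->
    {subset E <= M} -> {subset F <= M} -> forall x, x \in M.

Definition defined_over (L0 E0 : {pred L}) :=
  [/\ divring_closed E0, contains_ground E0, {subset E0 <= L0} &
   exists E : {pred L},
     [/\ divring_closed E, {subset E0 <= E},
         (exists m, has_degree E0 E m /\ has_degree L0 (@predT L) m) &
         compositum_full E L0]].

Definition alg_independent m (x : 'I_m -> L) :=
  forall p : {mpoly K[m]}, mmap iota x p = 0 -> p = 0.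

(* The transcendence degree over K is the largest size of an algebraically    *)
(* independent family.                                                        *)
Definition has_trdeg (E : {pred L}) d :=
  (exists x : 'I_d -> L, (forall i, x i \in E) /\ alg_independent x) /\
  (forall m (x : 'I_m -> L),
     (forall i, x i \in E) -> alg_independent x -> (m <= d)%N).

(* ed_K(L/L0) = d *)
Definition is_ed (L0 : {pred L}) d :=
  (exists2 E0 : {pred L}, defined_over L0 E0 & has_trdeg E0 d) /\
  (forall (E0 : {pred L}) e,
     defined_over L0 E0 -> has_trdeg E0 e -> (d <= e)%N).

End EssentialDimension.

Section RationalFunctions.

Variables (K : fieldType) (n : nat).

Notation "x %:F" := (@tofrac _ x).

(* K(x_1, ..., x_n) *)
Notation ratfun := {fraction {mpoly K[n]}}.

Definition ratfunC : K -> ratfun := fun a => (a%:MP)%:F.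

Fact ratfunC_is_zmod_morphism : zmod_morphism ratfunC.
Proof. by move=> a b; rewrite /ratfunC !rmorphB. Qed.
Fact ratfunC_is_monoid_morphism : monoid_morphism ratfunC.
Proof. by split=> [|a b]; rewrite /ratfunC ?rmorph1 // !rmorphM. Qed.
HB.instance Definition _ :=
  GRing.isZmodMorphism.Build K ratfun ratfunC ratfunC_is_zmod_morphism.
HB.instance Definition _ :=
  GRing.isMonoidMorphism.Build K ratfun ratfunC ratfunC_is_monoid_morphism.

Lemma ratfun_numden (x : ratfun) :
  x = (\n_(repr x))%:F / (\d_(repr x))%:F.
Proof.
have d0 := denom_ratioP (repr x).
apply: (canRL (mulfK _)); first by rewrite tofrac_eq0.
rewrite -{1}[x]reprK !piE.
apply/eqP; rewrite /FracField.mulf.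
rewrite FracField.equivf_def.
by rewrite !numden_Ratio ?oner_neq0 ?mulr1 ?mul1r // mulrC.
Qed.

End RationalFunctions.

Section LinearAction.

Variables (K : fieldType) (gT : finGroupType) (G : {group gT}) (n : nat).
Variable rG : mx_representation K G n.

Notation "x %:F" := (@tofrac _ x).

(* G acts on V = K^n (columns) by v |-> rG g *m v, hence on functions by      *)
(* (g f)(v) = f (g^-1 v), so that g x_i = \sum_j (rG g^-1)_ij x_j.            *)
Definition poly_act (g : gT) (p : {mpoly K[n]}) : {mpoly K[n]} :=
  p \mPo [tuple \sum_(j < n) rG (g^-1)%g i j *: 'X_j | i < n].

Definition ratfun_act (g : gT) (x : {fraction {mpoly K[n]}}) : {fraction {mpoly K[n]}} :=
  (poly_act g (\n_(repr x)))%:F / (poly_act g (\d_(repr x)))%:F.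

(* K(V)^G *)
Definition fixed_field : {pred {fraction {mpoly K[n]}}} :=
  [pred x | [forall (g | g \in G), ratfun_act g x == x]].

Definition is_ed_repr (d : nat) := is_ed (@ratfunC K n) fixed_field d.

(* ratfun_act is the extension of poly_act to the fraction field; it does not *)
(* depend on the choice of a fraction made by repr.                           *)
Lemma poly_actM g p q : poly_act g (p * q) = poly_act g p * poly_act g q.
Proof. by rewrite /poly_act rmorphM. Qed.

Lemma poly_act_comp g h p :
  g \in G -> h \in G -> poly_act (g * h)%g p = poly_act g (poly_act h p).
Proof.
move=> gG hG.
rewrite /poly_act [X in X \mPo _](mpolyE p).
rewrite [X in _ = (X \mPo _) \mPo _](mpolyE p).
have sumE (lq : n.-tuple {mpoly K[n]}) (F : 'X_{1..n} -> {mpoly K[n]}) :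
  (\sum_(m <- msupp p) F m) \mPo lq = \sum_(m <- msupp p) (F m \mPo lq).
  exact: raddf_sum.
rewrite !sumE; apply: eq_bigr => m _.
rewrite !comp_mpolyZ; congr (_ *: _).
rewrite !comp_mpolyX rmorph_prod /=; apply: eq_bigr => i _.
rewrite rmorphXn /=; congr (_ ^+ _).
rewrite !tnth_mktuple raddf_sum /=.
under [RHS]eq_bigr => j _.
  rewrite comp_mpolyZ comp_mpolyXU -tnth_nth tnth_mktuple scaler_sumr.
  over.
rewrite exchange_big /=; apply: eq_bigr => k _.
rewrite invMg repr_mxM ?groupV // mxE scaler_suml.
by apply: eq_bigr => j _; rewrite scalerA.
Qed.

Lemma poly_act1 p : poly_act 1%g p = p.
Proof.
rewrite -[RHS]comp_mpoly_id /poly_act; congr (_ \mPo _).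
apply: eq_mktuple => i; rewrite invg1 repr_mx1.
rewrite (bigD1 i) //= mxE eqxx scale1r big1 ?addr0 // => j /negPf ji.
by rewrite mxE eq_sym ji scale0r.
Qed.

Lemma poly_act_eq0 g p : g \in G -> (poly_act g p == 0) = (p == 0).
Proof.
move=> gG; apply/eqP/eqP => [p0|->]; last by rewrite /poly_act comp_mpoly0.
rewrite -[p]poly_act1 -(mulVg g) poly_act_comp ?groupV // p0.
by rewrite /poly_act comp_mpoly0.
Qed.

Lemma ratfun_actE g (a b : {mpoly K[n]}) : g \in G -> b != 0 ->
  ratfun_act g (a%:F / b%:F) = (poly_act g a)%:F / (poly_act g b)%:F.
Proof.
move=> gG b0; rewrite /ratfun_act; set x : {fraction {mpoly K[n]}} := a%:F / b%:F.
have d0 := denom_ratioP (repr x).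
apply/eqP; rewrite eqr_div ?tofrac_eq0 ?poly_act_eq0 //.
rewrite -!tofracM tofrac_eq -!poly_actM; apply/eqP; congr poly_act.
apply/eqP; rewrite -tofrac_eq !tofracM -eqr_div ?tofrac_eq0 //.
by rewrite -(ratfun_numden x).
Qed.

End LinearAction.

(* ed_K(G) = d. As ed_K(K(V)/K(V)^G) is independent of the faithful           *)
(* representation V, it is required to be d for every such V (and there is    *)
(* one, the regular representation).                                          *)
Definition is_ed_group (K : fieldType) (gT : finGroupType) (G : {group gT})
    (d : nat) :=
  forall n (rG : mx_representation K G n),
    mx_faithful rG -> is_ed_repr rG d.

Definition has_primitive_root (K : fieldType) (m : nat) :=
  exists z : K, m.-primitive_root z.

(* Main.v *)
Require Import Defs.
From HB Require Import structures.
From mathcomp Require Import all_boot all_order all_algebra all_fingroup.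
From mathcomp Require Import all_solvable all_character.
From mathcomp Require Import boolp.
From mathcomp Require Import generic_quotient fraction mpoly.
From mathcomp Require Import zify.

(** Why the theorem is true.

    The field of definition E0 in the essential dimension of K(V)/K(V)^G may
    be traded for a subfield F of K(V) that contains K, is stable under G and
    on which G acts faithfully.  By Artin's theorem K(V)/K(V)^G is defined over
    F^G ([defined_over_fixed]); conversely, if it is defined over E0, then the
    elements all of whose conjugates are algebraic over E0 form such an F of
    the same transcendence degree ([defined_over_ed_le]).  Hence ed_K(G) is the
    least transcendence degree of an F as above; [ed_le] says that it is at
    most d, and makes sense for every field L with a faithful action of G.

    This number may be computed in any such L whose fixed field contains an
    element of infinite multiplicative order ([ed_le_transfer]).  Given F in
    K(V), Galois descent provides a G-equivariant L-valued point phi of V at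
    which a prescribed nonzero polynomial does not vanish.  Evaluation at phi
    is a partially defined map from K(V) to L; it sends F onto a stable
    subfield of L of no larger transcendence degree, and a suitable choice of
    the polynomial keeps the action faithful.  In particular the essential
    dimension does not depend on V.

    Upper bound ([ed_le_upper]).  Inside L = K(W), for W faithful for G, put a
    copy of an optimal field for G', on which sigma acts trivially, and add an
    eigenvector y on which G acts through a character that is faithful on
    <sigma>; it exists since K contains a primitive p-th root of unity.  The
    transcendence degree grows by at most one.

    Lower bound ([ed_le_lower]).  Take L = k(t) with k = K(V'), for V' faithful
    for G'; let G act on k through G' and on t by the character.  Let F be an
    optimal field for G inside L.  The t-adic valuation is nontrivial on F,
    because sigma acts trivially on the residue field k but not on F.  So the
    residue field of F, a stable subfield of k, has smaller transcendence
    degree ([trdeg_le_residue]), and it remains to see that G' acts faithfully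
    on it.  Let I be the subgroup of G acting trivially on it, and pi a
    uniformizer of F.  Sending g to the residue of g(pi)/pi is a homomorphism
    from I to the roots of unity of k, which lie in K.  Its kernel, the wild
    inertia group, is normal in G and its elements of prime order have order
    char K ([wild_order]), so hypothesis (i) makes it trivial.  Therefore I is
    central and embeds into the multiplicative group of K
    ([res_inertia_character]).  An element of prime order q in I and G' would
    lie in the center of G' and give a primitive q-th root of unity of K; by
    (iv) this forces q = p, but sigma is in I and already accounts for all
    p-th roots of unity, so the element would be a power of sigma, which is
    absurd ([central_inertia_disjoint]). *)

Set Implicit Arguments.
Unset Strict Implicit.
Unset Printing Implicit Defensive.

Import GRing.Theory.
Local Open Scope ring_scope.

Notation "x %:F" := (@tofrac _ x) : ring_scope.

(** * Polynomial rings and their fraction fields *)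

Section Generalities.

Lemma mpoly_ord0_const (K : nzRingType) (p : {mpoly K[0]}) : p = (p@_0)%:MP.
Proof.
apply/mpolyP => m; rewrite mcoeffC.
have -> : m = 0%MM by apply/mnmP => -[].
by rewrite eqxx mulr1.
Qed.

Lemma alg_independent0 (K L : fieldType) (iota : {rmorphism K -> L}) (x : 'I_0 -> L) :
  alg_independent iota x.
Proof.
move=> p; rewrite (mpoly_ord0_const p) mmapC => /eqP.
by rewrite fmorph_eq0 => /eqP ->; rewrite mpolyC0.
Qed.

Lemma mpoly_rmorph_ext (K : nzRingType) n (S : nzRingType)
    (f g : {rmorphism {mpoly K[n]} -> S}) :
  (forall c, f c%:MP = g c%:MP) -> (forall i, f 'X_i = g 'X_i) -> f =1 g.
Proof.
move=> eqC eqX p; rewrite (mpolyE p) !rmorph_sum; apply: eq_bigr => m _.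
rewrite -mul_mpolyC !rmorphM eqC; congr (_ * _).
rewrite mpolyXE_id !rmorph_prod; apply: eq_bigr => i _.
by rewrite !rmorphXn eqX.
Qed.

Lemma muni_X (R : nzRingType) n (i : 'I_n.+1) :
  muni ('X_i : {mpoly R[n.+1]}) =
  if unlift ord_max i is Some j then ('X_j)%:P else 'X.
Proof.
rewrite /muni mmapX mmap1U.
case: unliftP => [j ->|->]; case: splitP => /= j'.
- rewrite /bump leqNgt ltn_ord add0n => E; congr ('X_ _)%:P.
  exact/val_inj.
- by rewrite ord1 addn0 /bump leqNgt ltn_ord add0n => E; move: (ltn_ord j); rewrite E ltnn.
- by move=> E; move: (ltn_ord j'); rewrite -E ltnn.
- by [].
Qed.

(** The added entry comes last because [muni] singles out the last variable. *)
Definition fam_rcons (T : Type) n (x : 'I_n -> T) (z : T) : 'I_n.+1 -> T :=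
  fun i => if unlift ord_max i is Some j then x j else z.

(** Algebraic relations of a longer family are read as polynomial equations
    satisfied by its last member. *)
Lemma mmap_fam_rcons (K L : fieldType) (iota : {rmorphism K -> L}) n
    (x : 'I_n -> L) z (p : {mpoly K[n.+1]}) :
  mmap iota (fam_rcons x z) p = (map_poly (mmap iota x) (muni p)).[z].
Proof.
pose g : {rmorphism _ -> _} := horner_eval z \o (map_poly (mmap iota x) \o @muni n K).
have -> : (map_poly (mmap iota x) (muni p)).[z] = g p by [].
pose f : {rmorphism _ -> _} := mmap iota (fam_rcons x z).
apply: (@mpoly_rmorph_ext _ _ _ f g) => [c|i] /=.
  by rewrite mmapC muniC map_polyC /horner_eval hornerC /= mmapC.
rewrite muni_X mmapX mmap1U /fam_rcons; case: unlift => [j|] /=.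
  by rewrite map_polyC /horner_eval hornerC /= mmapX mmap1U.
by rewrite map_polyX /horner_eval hornerX.
Qed.

Lemma muni_inj (K : fieldType) n : injective (@muni n K).
Proof.
pose h : {rmorphism _ -> _} :=
  horner_eval ('X_ord_max : {mpoly K[n.+1]}) \o (map_poly (@mwiden n K) \o @muni n K).
have hK p : h p = p.
  apply: (@mpoly_rmorph_ext _ _ _ h idfun) => [c|i] /=.
    by rewrite muniC map_polyC /horner_eval hornerC /= mwidenC.
  rewrite muni_X; case: unliftP => [j ->|->] /=; last by rewrite map_polyX /horner_eval hornerX.
  rewrite map_polyC /horner_eval hornerC /= mwidenX mnmwiden1; congr 'X_ _.
  by apply/val_inj; rewrite /= /bump leqNgt ltn_ord.
by move=> p q E; rewrite -(hK p) -(hK q) /= E.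
Qed.

End Generalities.

Section FractionPlace.

Variables (R : idomainType) (E : fieldType) (f : {rmorphism R -> E}).

Lemma frac_reprE (u : {fraction R}) :
  u = (\n_(repr u))%:F / (\d_(repr u))%:F.
Proof.
have d0 := denom_ratioP (repr u).
apply: (canRL (mulfK _)); first by rewrite tofrac_eq0.
rewrite -{1}[u]reprK !piE; apply/eqP; rewrite /FracField.mulf.
rewrite FracField.equivf_def.
by rewrite !numden_Ratio ?oner_neq0 ?mulr1 ?mul1r // mulrC.
Qed.

Lemma frac_numden (u : {fraction R}) :
  exists a b : R, b != 0 /\ u = a%:F / b%:F.
Proof.
exists (\n_(repr u)), (\d_(repr u)); split; first exact: denom_ratioP.
exact: frac_reprE.
Qed.

(** The graph of f on the localization of R at the kernel of f.  A relation
    is used because this map is only partially defined on the fraction field. *)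
Definition frac_place (u : {fraction R}) (w : E) : Prop :=
  exists a b : R, [/\ f b != 0, u = a%:F / b%:F & w = f a / f b].

Let nz b : f b != 0 -> b%:F != 0 :> {fraction R}.
Proof. by rewrite tofrac_eq0; apply: contraNneq => ->; rewrite rmorph0. Qed.

Lemma frac_placeF a : frac_place a%:F (f a).
Proof. by exists a, 1; rewrite !rmorph1 oner_neq0 !divr1. Qed.

Lemma frac_placeD u v x y :
  frac_place u x -> frac_place v y -> frac_place (u + v) (x + y).
Proof.
move=> [a [b [b0 -> ->]]] [c [d [d0 -> ->]]].
exists (a * d + c * b), (b * d); split.
- by rewrite rmorphM mulf_neq0.
- by rewrite addf_div ?nz // rmorphD !rmorphM.
- by rewrite addf_div // rmorphD !rmorphM.
Qed.

Lemma frac_placeM u v x y :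
  frac_place u x -> frac_place v y -> frac_place (u * v) (x * y).
Proof.
move=> [a [b [b0 -> ->]]] [c [d [d0 -> ->]]].
exists (a * c), (b * d); split; first by rewrite rmorphM mulf_neq0.
- by rewrite mulf_div !rmorphM.
- by rewrite mulf_div !rmorphM.
Qed.

Lemma frac_place0 w : frac_place 0 w -> w = 0.
Proof.
move=> [a [b [b0 E0 ->]]]; move/esym/eqP: E0.
by rewrite mulf_eq0 invr_eq0 (negPf (nz b0)) orbF tofrac_eq0 => /eqP ->; rewrite rmorph0 mul0r.
Qed.

Lemma frac_placeV u x : frac_place u x -> x != 0 -> frac_place u^-1 x^-1.
Proof.
move=> [a [b [b0 -> ->]]] n0; exists b, a; split.
- by apply: contraNneq n0 => ->; rewrite mul0r.
- by rewrite invf_div.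
- by rewrite invf_div.
Qed.

Hypothesis f_inj : injective f.

Let f0 b : b != 0 -> f b != 0.
Proof. by rewrite -(rmorph0 f) (inj_eq f_inj). Qed.

(** The proof that f is injective is an argument so that the ring morphism
    structure below can be attached to the term. *)
Definition frac_lift of injective f := fun u : {fraction R} =>
   f (\n_(repr u)) / f (\d_(repr u)).

Local Notation lift := (frac_lift f_inj).

Lemma frac_liftE a b : b != 0 -> lift (a%:F / b%:F) = f a / f b.
Proof.
move=> b0; set u := _ / _.
have d0 := denom_ratioP (repr u).
apply/eqP; rewrite /frac_lift eqr_div ?f0 // -!rmorphM; apply/eqP; congr (f _).
apply/eqP; rewrite -tofrac_eq !tofracM -eqr_div ?tofrac_eq0 //.
by rewrite -(frac_reprE u).
Qed.

Lemma frac_lift_zmod : zmod_morphism lift.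
Proof.
move=> u v; have [a [b [b0 ->]]] := frac_numden u.
have [c [d [d0 ->]]] := frac_numden v.
rewrite -mulNr addf_div ?tofrac_eq0 // -rmorphN -!rmorphM -rmorphD.
rewrite !frac_liftE ?mulf_neq0 //.
by rewrite -mulNr addf_div ?f0 // rmorphD !rmorphM rmorphN.
Qed.

Lemma frac_lift_monoid : monoid_morphism lift.
Proof.
split=> [|u v].
  by rewrite -[1]divr1 -tofrac1 frac_liftE ?oner_neq0 // rmorph1 divr1.
have [a [b [b0 ->]]] := frac_numden u; have [c [d [d0 ->]]] := frac_numden v.
by rewrite mulf_div -!rmorphM !frac_liftE ?mulf_neq0 // mulf_div !rmorphM.
Qed.

HB.instance Definition _ :=
  GRing.isZmodMorphism.Build {fraction R} E lift frac_lift_zmod.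
HB.instance Definition _ :=
  GRing.isMonoidMorphism.Build {fraction R} E lift frac_lift_monoid.

Lemma frac_liftF a : lift a%:F = f a.
Proof. by rewrite -[X in lift X]divr1 -tofrac1 frac_liftE ?oner_neq0 // rmorph1 divr1. Qed.

End FractionPlace.

(** * Counting bound for algebraically independent families *)

Lemma card_bmultinom_le d M : (#|{: 'X_{1..d < M.+1}}| <= M.+1 ^ d)%N.
Proof.
pose f (m : 'X_{1..d < M.+1}) : {ffun 'I_d -> 'I_M.+1} := [ffun i => inord (m i)].
have f_inj : injective f.
  move=> m1 m2 /ffunP E; apply/val_inj/mnmP => i.
  have le (m : 'X_{1..d < M.+1}) : (m i < M.+1)%N.
    apply: leq_ltn_trans (bmdeg m); rewrite mdegE (bigD1 i) //= leq_addr.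
    by [].
  by have := E i; rewrite !ffunE => /(congr1 val); rewrite /= !inordK.
by have := leq_card f f_inj; rewrite card_ffun !card_ord.
Qed.

Section Counting.

Variables (K L : fieldType) (iota : {rmorphism K -> L}).
Variables (d m : nat) (x : 'I_d -> L) (y : 'I_m -> L).

Local Notation ev := (mmap iota x).
Local Notation "c %:E" := (mmap iota x c) (at level 2, format "c %:E").

(** The situation after clearing denominators: all y i satisfy equations of
    one degree r.+1 over K[x] with one leading coefficient c. *)
Section Reduction.

Variables (r : nat) (c : {mpoly K[d]}) (a : 'I_m -> nat -> {mpoly K[d]}).
Hypothesis c0 : c%:E != 0.
Hypothesis yE : forall i, c%:E * y i ^+ r.+1 = \sum_(j < r.+1) (a i j)%:E * y i ^+ j.
Variable D : nat.
Hypothesis cD : (msize c <= D)%N.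
Hypothesis aD : forall i (j : 'I_r.+1), (msize (a i j) <= D)%N.

Local Notation T := {ffun 'I_m -> 'I_r.+1}.
Definition ymon (g : T) := \prod_i y i ^+ g i.

(** Over K these elements form a space of dimension O(N^d).  A product of
    powers of the y i, rewritten by means of the equations, falls into it for
    N proportional to the degree, at the price of a power of c; and there are
    more such products than N^d allows as soon as m > d. *)
Definition bounded_comb N z := exists q : T -> {mpoly K[d]},
  (forall g, msize (q g) <= N.+1)%N /\ z = \sum_g (q g)%:E * ymon g.
Local Notation W := bounded_comb.

Lemma bounded_comb_term N q g : (msize q <= N.+1)%N -> W N (q%:E * ymon g).
Proof.
move=> qN; exists (fun h => if h == g then q else 0); split=> [h|].
  by case: eqP => // _; rewrite msize0.
rewrite (bigD1 g) //= eqxx big1 ?addr0 // => h /negPf ->.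
by rewrite mmap0 mul0r.
Qed.

Lemma bounded_comb_sum N (I : finType) (F : I -> L) : (forall i, W N (F i)) -> W N (\sum_i F i).
Proof.
move=> WF; elim/big_ind: _ => // [|u v [q [qN ->]] [q' [q'N ->]]].
  exists (fun=> 0); split=> [h|]; first by rewrite msize0.
  by rewrite big1 // => h _; rewrite mmap0 mul0r.
exists (fun g => q g + q' g); split=> [g|].
  by apply: leq_trans (msizeD_le _ _) _; rewrite geq_max qN q'N.
by rewrite -big_split; apply: eq_bigr => g _; rewrite /= mmapD mulrDl.
Qed.

Lemma msizeM_bound N (p q : {mpoly K[d]}) : (msize p <= D)%N -> (msize q <= N.+1)%N ->
  (msize (p * q) <= (N + D.+1).+1)%N.
Proof. by move=> pD qN; apply: leq_trans (msizeM_le _ _) _; lia. Qed.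

Lemma bounded_comb_lead N z : W N z -> W (N + D.+1) (c%:E * z).
Proof.
move=> [q [qN ->]]; rewrite mulr_sumr; apply: bounded_comb_sum => g.
by rewrite mulrA -rmorphM; apply/bounded_comb_term/msizeM_bound.
Qed.

Definition set_exponent (g : T) i (j : 'I_r.+1) : T := [ffun k => if k == i then j else g k].

Lemma ymon_set_exponent g i j :
  ymon (set_exponent g i j) = y i ^+ j * \prod_(k | k != i) y k ^+ g k.
Proof.
rewrite /ymon (bigD1 i) //= ffunE eqxx; congr (_ * _).
by apply: eq_bigr => k /negPf ki; rewrite ffunE ki.
Qed.

Lemma bounded_comb_step N z i : W N z -> W (N + D.+1) (c%:E * (y i * z)).
Proof.
move=> [q [qN ->]]; rewrite !mulr_sumr; apply: bounded_comb_sum => g.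
set w := \prod_(k | k != i) y k ^+ g k.
have -> : ymon g = y i ^+ g i * w by rewrite /ymon (bigD1 i).
have [lt|ge] := ltnP (g i).+1 r.+1.
  have -> : c%:E * (y i * ((q g)%:E * (y i ^+ g i * w))) =
            (c * q g)%:E * ymon (set_exponent g i (Ordinal lt)).
    rewrite ymon_set_exponent /= exprS rmorphM -/w /= -!mulrA; congr (_ * _).
    by rewrite mulrCA.
  by apply/bounded_comb_term/msizeM_bound.
have gi : g i = r :> nat by have := ltn_ord (g i); lia.
have -> : c%:E * (y i * ((q g)%:E * (y i ^+ g i * w))) =
          (c%:E * y i ^+ r.+1) * ((q g)%:E * w).
  by rewrite gi exprS -!mulrA; do 2!congr (_ * _); rewrite mulrCA.
rewrite yE mulr_suml; apply: bounded_comb_sum => j.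
have -> : (a i j)%:E * y i ^+ j * ((q g)%:E * w) = (a i j * q g)%:E * ymon (set_exponent g i j).
  by rewrite ymon_set_exponent rmorphM -/w /= mulrACA !mulrA.
exact/bounded_comb_term/msizeM_bound.
Qed.

Lemma bounded_comb_iter N z i k e : (e <= k)%N -> W N z ->
  W (N + D.+1 * k) (c%:E ^+ k * (y i ^+ e * z)).
Proof.
elim: k e => [|k IH] e; first by rewrite leqn0 muln0 addn0 => /eqP -> Wz; rewrite !expr0 !mul1r.
rewrite mulnS addnCA addnC => le Wz.
case: e le => [|e] le.
  rewrite expr0 mul1r exprS -mulrA; apply/bounded_comb_lead.
  by have := IH 0%N isT Wz; rewrite expr0 mul1r.
rewrite [c%:E ^+ _]exprS [y i ^+ _]exprS.
have -> : c%:E * c%:E ^+ k * (y i * y i ^+ e * z) = c%:E * (y i * (c%:E ^+ k * (y i ^+ e * z))).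
  by rewrite -!mulrA; congr (_ * _); rewrite mulrCA.
by apply/bounded_comb_step/IH.
Qed.

Lemma bounded_comb_monomial n (al : 'I_m -> nat) : (forall i, al i <= n)%N ->
  W (D.+1 * n * m) (c%:E ^+ (n * m) * \prod_i y i ^+ al i).
Proof.
move=> aln; suff H (s : seq 'I_m) : W (D.+1 * n * size s)
    (c%:E ^+ (n * size s) * \prod_(i <- s) y i ^+ al i).
  have := H (index_enum 'I_m).
  by rewrite (_ : size _ = m) // -sum1_size big_const_ord iter_addn_0 mul1n.
elim: s => [|i s IH] /=.
  rewrite !muln0 expr0 mul1r big_nil.
  exists (fun g => if g == [ffun=> ord0] then 1 else 0); split=> [g|].
    by case: ifP; rewrite ?msize1 ?msize0.
  rewrite (bigD1 [ffun=> ord0]) //= eqxx [X in _ + X]big1 ?addr0; last first.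
    by move=> g /negPf ->; rewrite mmap0 mul0r.
  by rewrite rmorph1 mul1r /ymon big1 // => k _; rewrite ffunE.
rewrite big_cons !mulnS addnC exprD.
have -> : c%:E ^+ n * c%:E ^+ (n * size s) * (y i ^+ al i * \prod_(j <- s) y j ^+ al j) =
  c%:E ^+ n * (y i ^+ al i * (c%:E ^+ (n * size s) * \prod_(j <- s) y j ^+ al j)).
  by rewrite -!mulrA; congr (_ * _); rewrite mulrCA.
exact: bounded_comb_iter.
Qed.

(** The n^m products with exponents below n, multiplied by a common power of
    c, lie in a space of dimension at most r.+1^m (M.+1)^d with M linear in n;
    for n large this is smaller than n^m, and a linear relation between the
    products is an algebraic relation between the y i. *)
Lemma reduction_dependent : (d < m)%N -> ~ alg_independent iota y.
Proof.
move=> ltdm indep.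
(* the least n with r.+1^m (D' n)^d < n^(d+1), where D' is (D.+1 * m).+1 *)
pose n := (r.+1 ^ m * (D.+1 * m).+1 ^ d).+1.
pose A := {ffun 'I_m -> 'I_n}; pose M := (D.+1 * n * m)%N.
pose C := (T * 'X_{1..d < M.+1})%type.
have ltCA : (#|{: C}| < #|{: A}|)%N.
  rewrite card_prod !card_ffun !card_ord.
  apply: (@leq_ltn_trans (r.+1 ^ m * ((D.+1 * m).+1 * n) ^ d)).
    rewrite leq_mul2l; apply/orP; right; apply: leq_trans (card_bmultinom_le _ _) _.
    case: (d) => // e; rewrite leq_exp2r // /M mulnAC mulSn.
    exact: (@leq_add 1 _ n _ isT (leqnn _)).
  rewrite expnMn mulnA; apply: (@leq_trans (n ^ d.+1)); last by rewrite leq_pexp2l.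
  by rewrite expnS ltn_pmul2r ?expn_gt0.
have /fin_all_exists [q qP] : forall al : A, exists q : T -> {mpoly K[d]},
    (forall g, msize (q g) <= M.+1)%N /\
    c%:E ^+ (n * m) * \prod_i y i ^+ al i = \sum_g (q g)%:E * ymon g.
  by move=> al; apply: bounded_comb_monomial => i; apply/ltnW.
pose X := \matrix_(i < #|{: A}|, j < #|{: C}|)
   (q (enum_val i) (enum_val j).1)@_((enum_val j).2).
have : kermx X != 0.
  by rewrite -mxrank_eq0 mxrank_ker -lt0n subn_gt0; apply: leq_ltn_trans ltCA; apply: rank_leq_col.
case/rowV0Pn => u /sub_kermxP uX u0.
pose mo (al : A) : 'X_{1..m} := [multinom (al i : nat) | i < m].
have mo_inj : injective mo.
  move=> a1 a2 /mnmP E; apply/ffunP => i; apply/val_inj.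
  by have := E i; rewrite !mnmE.
pose P : {mpoly K[m]} := \sum_(k < #|{: A}|) u 0 k *: 'X_[mo (enum_val k)].
have comb g : \sum_k u 0 k *: q (enum_val k) g = 0.
  apply/mpolyP => mon; rewrite mcoeff0 raddf_sum /=.
  have [lt|ge] := ltnP (mdeg mon) M.+1.
    have /matrixP /(_ 0 (enum_rank ((g, BMultinom lt) : C))) := uX.
    rewrite !mxE => E; rewrite -[RHS]E; apply: eq_bigr => k _.
    by rewrite mxE enum_rankK mcoeffZ.
  apply: big1 => k _; rewrite mcoeffZ memN_msupp_eq0 ?mulr0 //.
  apply: msize_mdeg_ge; apply: leq_trans ge; exact: (qP _).1.
have P0 : P = 0.
  apply: indep; apply/eqP; rewrite -(mulrI_eq0 _ (mulfI (expf_neq0 (n * m) c0))); apply/eqP.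
  rewrite raddf_sum mulr_sumr /=.
  under eq_bigr => k _.
    rewrite mmapZ mmapX mulrCA; have -> : mmap1 y (mo (enum_val k)) = \prod_i y i ^+ (enum_val k) i.
      by apply: eq_bigr => i _; rewrite mnmE.
    rewrite (qP _).2 mulr_sumr; over.
  rewrite exchange_big big1 //= => g _.
  transitivity ((\sum_k u 0 k *: q (enum_val k) g)%:E * ymon g).
    by rewrite raddf_sum mulr_suml; apply: eq_bigr => k _; rewrite /= mmapZ mulrA.
  by rewrite comb mmap0 mul0r.
case/negP: u0; apply/eqP/rowP => k; rewrite mxE.
have := congr1 (mcoeff (mo (enum_val k))) P0.
rewrite mcoeff0 raddf_sum (bigD1 k) //= mcoeffZ mcoeffX eqxx mulr1 big1 ?addr0 //.
move=> k' /negPf kk'; rewrite mcoeffZ mcoeffX (inj_eq mo_inj) (inj_eq enum_val_inj) kk'.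
by rewrite mulr0.
Qed.

End Reduction.

Definition algebraic_in z := exists p : {poly {mpoly K[d]}},
  map_poly ev p != 0 /\ root (map_poly ev p) z.

(** The exchange property of transcendence degree, by counting dimensions. *)
Lemma algebraic_family_bound :
  (forall i, algebraic_in (y i)) -> alg_independent iota y -> (m <= d)%N.
Proof.
move=> /fin_all_exists [p pP] indep; rewrite leqNgt; apply/negP => ltdm.
pose s i := size (map_poly ev (p i)).
have s_gt1 i : (1 < s i)%N by apply: root_size_gt1 (pP i).2; apply: (pP i).1.
pose r := (\sum_i s i)%N.
have rs i : (s i <= r)%N by rewrite /r (bigD1 i) //= leq_addr.
(* Coefficients of p i above the degree of its image are dropped; then a
   power of the variable brings all degrees to r.+1. *)
pose Q i := (\poly_(j < s i) (p i)`_j) * 'X^(r.+1 - (s i).-1).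
have QE i : map_poly ev (Q i) = map_poly ev (p i) * 'X^(r.+1 - (s i).-1).
  rewrite rmorphM /= map_polyXn; congr (_ * _); apply/polyP => j.
  rewrite !coef_map coef_poly; case: ltnP => //= le.
  by rewrite rmorph0 -coef_map nth_default.
have Qsize i : (size (Q i) <= r.+2)%N.
  apply: leq_trans (size_polyMleq _ _) _; rewrite size_polyXn addnS /=.
  apply: leq_trans (leq_add (size_poly _ _) (leqnn _)) _.
  by move: (s i) (rs i) (s_gt1 i) => s' ? ?; lia.
have Qlead i : ev ((Q i)`_r.+1) != 0.
  rewrite /Q coefMXn ifF; last by move: (s i) (rs i) (s_gt1 i) => s' ? ?; lia.
  rewrite subKn; last by move: (s i) (rs i) (s_gt1 i) => s' ? ?; lia.
  rewrite coef_poly prednK ?leqnn; last exact: ltnW (s_gt1 i).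
  by rewrite -coef_map -lead_coefE lead_coef_eq0 (pP i).1.
have Qroot i : (map_poly ev (Q i)).[y i] = 0.
  by rewrite QE hornerM (rootP (pP i).2) mul0r.
pose c := \prod_i (Q i)`_r.+1.
(* the equation of y i is multiplied by the other leading coefficients *)
pose a i j := - ((\prod_(k | k != i) (Q k)`_r.+1) * (Q i)`_j).
have c0 : c%:E != 0 by rewrite rmorph_prod; apply/prodf_neq0 => i _; apply: Qlead.
have yE i : c%:E * y i ^+ r.+1 = \sum_(j < r.+1) (a i j)%:E * y i ^+ j.
  have := Qroot i; rewrite (@horner_coef_wide _ r.+2); last first.
    exact: leq_trans (size_poly _ _) (Qsize i).
  rewrite big_ord_recr /= coef_map /= => /eqP; rewrite addrC addr_eq0 => /eqP E.
  rewrite /c (bigD1 i) //= rmorphM mulrC mulrA (mulrC (y i ^+ _)) E mulNr mulr_suml -sumrN.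
  apply: eq_bigr => j _; rewrite coef_map /a rmorphN rmorphM /= mulNr.
  by congr (- _); rewrite mulrAC; congr (_ * _); apply: mulrC.
pose D := maxn (msize c) (\max_i \max_(j < r.+1) msize (a i j)).
apply: (@reduction_dependent r c a c0 yE D _ _ ltdm indep) => [|i j]; first exact: leq_maxl.
apply: leq_trans (leq_maxr _ _); apply: leq_trans (leq_bigmax i).
exact: (leq_bigmax (F := fun j : 'I_r.+1 => msize (a i j)) j).
Qed.

End Counting.

(** * Transcendence degree and algebraic hulls *)

Section Subfields.

Variables (L : fieldType) (E : {pred L}) (cE : divring_closed E).

Lemma subfield1 : 1 \in E. Proof. by case: cE. Qed.
Lemma subfieldB : {in E &, forall u v, u - v \in E}. Proof. by case: cE. Qed.
Lemma subfield_div : {in E &, forall u v, u / v \in E}. Proof. by case: cE. Qed.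
Lemma subfield0 : 0 \in E. Proof. by rewrite -(subrr 1) subfieldB ?subfield1. Qed.
Lemma subfieldN : {in E, forall u, - u \in E}.
Proof. by move=> u uE; rewrite -sub0r subfieldB ?subfield0. Qed.
Lemma subfieldD : {in E &, forall u v, u + v \in E}.
Proof. by move=> u v uE vE; rewrite -(opprK v) subfieldB ?subfieldN. Qed.
Lemma subfieldV : {in E, forall u, u^-1 \in E}.
Proof. by move=> u uE; rewrite -div1r subfield_div ?subfield1. Qed.
Lemma subfieldM : {in E &, forall u v, u * v \in E}.
Proof. by move=> u v uE vE; rewrite -(invrK v) subfield_div ?subfieldV. Qed.
Lemma subfieldX n : {in E, forall u, u ^+ n \in E}.
Proof.
move=> u uE; elim: n => [|n IH]; first by rewrite expr0 subfield1.
by rewrite exprS subfieldM.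
Qed.
Lemma subfield_sum (I : Type) (r : seq I) (P : pred I) (F : I -> L) :
  (forall i, P i -> F i \in E) -> \sum_(i <- r | P i) F i \in E.
Proof.
by move=> FE; elim/big_ind: _ => //; [apply: subfield0 | apply: subfieldD].
Qed.
Lemma subfield_prod (I : Type) (r : seq I) (P : pred I) (F : I -> L) :
  (forall i, P i -> F i \in E) -> \prod_(i <- r | P i) F i \in E.
Proof.
by move=> FE; elim/big_ind: _ => //; [apply: subfield1 | apply: subfieldM].
Qed.

End Subfields.

Section Trdeg.

Variables (K L : fieldType) (iota : {rmorphism K -> L}).

(** Stated for any subset, so that a hull can be built on a generating set. *)
Definition trdeg_le (S : {pred L}) d := forall m (x : 'I_m -> L),
  (forall i, x i \in S) -> alg_independent iota x -> (m <= d)%N.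

Lemma trdeg_leS (S S' : {pred L}) d :
  {subset S <= S'} -> trdeg_le S' d -> trdeg_le S d.
Proof. by move=> sSS' S'd m x xS; apply: S'd => i; apply/sSS'. Qed.

Lemma trdeg_le_mon (S : {pred L}) d e : (d <= e)%N -> trdeg_le S d -> trdeg_le S e.
Proof. by move=> de Sd m x xS xi; apply: leq_trans de; apply: Sd xi. Qed.

Lemma trdeg_le_has_trdeg (S : {pred L}) d : trdeg_le S d ->
  exists2 s, (s <= d)%N & has_trdeg iota S s.
Proof.
move=> Sd; pose P s := `[< exists x : 'I_s -> L, (forall i, x i \in S) /\ alg_independent iota x >].
have P0 : exists s, P s.
  by exists 0%N; apply/asboolP; exists (fun=> 0); split=> [[]//|]; apply: alg_independent0.
have Pd s : P s -> (s <= d)%N by move/asboolP => [x [xS xi]]; apply: Sd xi.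
case: (ex_maxnP P0 Pd) => s Ps sM.
exists s; first exact: Pd.
split; first exact/asboolP.
by move=> m x xS xi; apply: sM; apply/asboolP; exists x.
Qed.

(** Subfields containing K and algebraically closed in L. *)
Definition relatively_closed (A : {pred L}) :=
  [/\ divring_closed A, contains_ground iota A &
   forall (p : {poly L}) z, p != 0 -> root p z -> (forall i, p`_i \in A) -> z \in A].

Section Hull.

Variables (d : nat) (x : 'I_d -> L).
Hypothesis x_indep : alg_independent iota x.

Lemma ev_inj : injective (mmap iota x).
Proof. by apply: raddf_inj => p /x_indep. Qed.

Local Notation j := (frac_lift ev_inj).

(** The elements algebraic over K(x), where K(x) is the image of the field of
    rational functions under the morphism that evaluation at the independent
    family x induces. *)
Definition hull : {pred L} := [pred z | `[< algebraicOver j z >]].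

Lemma hullP z : reflect (algebraicOver j z) (z \in hull).
Proof. exact: asboolP. Qed.

Lemma poly_frac_denom (R : idomainType) (p : {poly {fraction R}}) :
  exists2 b : R, b != 0 & exists q : {poly R}, b%:F *: p = map_poly (@tofrac R) q.
Proof.
elim/poly_ind: p => [|p c [b b0 [q qE]]].
  by exists 1; rewrite ?oner_neq0 //; exists 0; rewrite scaler0 rmorph0.
have [a [e [e0 ->]]] := frac_numden c.
exists (b * e); first by rewrite mulf_neq0.
exists (e *: (q * 'X) + (a * b)%:P).
have -> : map_poly (@tofrac R) (e *: (q * 'X) + (a * b)%:P) =
    e%:F *: (map_poly (@tofrac R) q * 'X) + (a%:F * b%:F)%:P.
  by rewrite rmorphD /= map_polyZ map_polyC rmorphM /= map_polyX /= rmorphM.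
rewrite -qE scalerDr -!scalerAl !scalerA; congr (_ + _).
  by rewrite rmorphM [X in X *: _]mulrC.
rewrite -mul_polyC -polyCM; congr (_%:P).
by rewrite rmorphM /= mulrC mulrA -!mulrA;
  congr (_ * _); rewrite mulrC -mulrA divff ?tofrac_eq0 // mulr1.
Qed.

Lemma hull_algebraic_in z : z \in hull -> algebraic_in iota x z.
Proof.
move/hullP => [p p0 pz]; have [b b0 [q qE]] := poly_frac_denom p.
exists q; have -> : map_poly (mmap iota x) q = j b%:F *: map_poly j p.
  rewrite -map_polyZ qE -map_poly_comp; apply: eq_map_poly => a /=.
  by rewrite frac_liftF.
have jb0 : j b%:F != 0 by rewrite fmorph_eq0 tofrac_eq0.
by rewrite scaler_eq0 negb_or map_poly_eq0 jb0 p0 rootZ.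
Qed.

Lemma algebraic_in_hull z : algebraic_in iota x z -> z \in hull.
Proof.
move=> [p [p0 pz]]; apply/hullP.
have E : map_poly (mmap iota x) p = map_poly j (map_poly (@tofrac _) p).
  by rewrite -map_poly_comp; apply: eq_map_poly => a /=; rewrite frac_liftF.
exists (map_poly (@tofrac _) p); last by rewrite -E.
by apply: contraNneq p0 => p0; rewrite E p0 rmorph0.
Qed.

Lemma hull_relatively_closed : relatively_closed hull.
Proof.
split=> [|a|p z p0 pz pA].
- split=> [|u v /hullP uA /hullP vA|u v /hullP uA /hullP vA]; apply/hullP.
  + exact: algebraic1.
  + exact: algebraic_sub.
  + exact: algebraic_div.
- apply/hullP; have -> : iota a = j (a%:MP)%:F by rewrite frac_liftF /= mmapC.
  exact: algebraic_id.
apply/hullP/integral_algebraic/(integral_root p0 pz)/integral_poly => i.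
exact/integral_algebraic/hullP.
Qed.

Lemma hull_gen i : x i \in hull.
Proof.
apply/hullP; have -> : x i = j ('X_i)%:F by rewrite frac_liftF /= mmapX mmap1U.
exact: algebraic_id.
Qed.

Lemma trdeg_le_hull : trdeg_le hull d.
Proof.
by move=> m y yA; apply: (@algebraic_family_bound _ _ iota _ _ x) => i; apply: hull_algebraic_in.
Qed.

Lemma alg_independent_rcons z : z \notin hull ->
  alg_independent iota (fam_rcons x z).
Proof.
move=> zA p; rewrite mmap_fam_rcons => pz.
apply: (@muni_inj _ _ p 0); rewrite rmorph0; apply/eqP.
apply: contraNT zA => p0; apply: algebraic_in_hull; exists (muni p); split.
  by rewrite map_poly_eq0_id0 // -(rmorph0 (mmap iota x)) (inj_eq ev_inj) lead_coef_eq0.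
exact/rootP.
Qed.

Lemma relatively_closed_sub_hull A : relatively_closed A -> (forall i, x i \in A) ->
  {subset hull <= A}.
Proof.
move=> [cA KA algA] xA z /hull_algebraic_in [p [p0 pz]].
apply: algA p0 pz _ => i; rewrite coef_map.
apply: subfield_sum => // m _; apply: subfieldM => //; first exact: KA.
by apply: subfield_prod => // k _; apply: subfieldX.
Qed.

End Hull.

(** A maximal independent family of S does it. *)
Lemma trdeg_le_sub_hull (S : {pred L}) d : trdeg_le S d ->
  exists s (x : 'I_s -> L) (xi : alg_independent iota x),
    (s <= d)%N /\ {subset S <= hull xi}.
Proof.
move=> /trdeg_le_has_trdeg [s sd [[x [xS xi]] sM]]; exists s, x, xi; split=> // z zS.
apply: contraT => /alg_independent_rcons /sM; rewrite ltnn => -> //.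
by move=> i; rewrite /fam_rcons; case: unlift.
Qed.

Lemma algebraic_hull (S : {pred L}) d : trdeg_le S d ->
  exists A : {pred L}, [/\ relatively_closed A, {subset S <= A} & trdeg_le A d].
Proof.
move=> /trdeg_le_sub_hull [s [x [xi [sd Sx]]]]; exists (hull xi); split=> //.
  exact: hull_relatively_closed.
exact/(trdeg_le_mon sd)/trdeg_le_hull.
Qed.

Lemma algebraic_hull_add (S : {pred L}) d z : trdeg_le S d ->
  exists A : {pred L}, [/\ relatively_closed A, {subset S <= A}, z \in A & trdeg_le A d.+1].
Proof.
move=> /trdeg_le_sub_hull [s [x [xi [sd Sx]]]]; have [zx|zx] := boolP (z \in hull xi).
  exists (hull xi); split=> //; first exact: hull_relatively_closed.
  exact/(trdeg_le_mon (leqW sd))/trdeg_le_hull.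
have xzi := alg_independent_rcons zx; exists (hull xzi).
have cl := hull_relatively_closed xzi; split=> // [u /Sx||].
- apply: (relatively_closed_sub_hull cl) => i.
  have -> : x i = fam_rcons x z (lift ord_max i) by rewrite /fam_rcons liftK.
  exact: hull_gen.
- by have := hull_gen xzi ord_max; rewrite {1}/fam_rcons unlift_none.
exact/(trdeg_le_mon (_ : (s.+1 <= d.+1)%N))/trdeg_le_hull.
Qed.

End Trdeg.

(** * Stable subfields and fields of definition *)

Section SubfieldDet.

Variables (L : fieldType) (E : {pred L}) (cE : divring_closed E).

Lemma subfield_det n (A : 'M[L]_n) : (forall i j, A i j \in E) -> \det A \in E.
Proof.
move=> AE; apply: subfield_sum => // s _; apply: subfieldM => //.
  by rewrite -signr_odd; case: odd; rewrite ?expr1 ?expr0 ?subfieldN ?subfield1.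
by apply: subfield_prod.
Qed.

Lemma subfield_invmx n (A : 'M[L]_n) : (forall i j, A i j \in E) ->
  forall i j, invmx A i j \in E.
Proof.
move=> AE i j; rewrite /invmx; case: ifP => // _.
rewrite !mxE; apply: subfieldM => //; first by apply/subfieldV/subfield_det.
apply: subfieldM => //; last by apply: subfield_det => k l; rewrite !mxE.
by rewrite -signr_odd; case: odd; rewrite ?expr1 ?expr0 ?subfieldN ?subfield1.
Qed.

Definition coefs_in (p : {poly L}) := forall i, p`_i \in E.

Lemma coefs_in_sum (I : Type) (r : seq I) (P : pred I) (F : I -> {poly L}) :
  (forall i, P i -> coefs_in (F i)) -> coefs_in (\sum_(i <- r | P i) F i).
Proof. by move=> FE k; rewrite coef_sum; apply: subfield_sum => // i /FE. Qed.

Lemma coefs_inM p q : coefs_in p -> coefs_in q -> coefs_in (p * q).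
Proof.
by move=> pE qE k; rewrite coefM; apply: subfield_sum => // i _; apply: subfieldM.
Qed.

Lemma coefs_inC c : c \in E -> coefs_in c%:P.
Proof. by move=> cin k; rewrite coefC; case: ifP => _ //; apply: subfield0. Qed.

Lemma coefs_in_char_poly n (A : 'M[L]_n) : (forall i j, A i j \in E) ->
  coefs_in (char_poly A).
Proof.
move=> AE; apply: coefs_in_sum => s _; apply: coefs_inM.
  rewrite -signr_odd; case: odd; rewrite ?expr1 ?expr0.
    by rewrite -polyCN; apply/coefs_inC/subfieldN/subfield1.
  by apply/coefs_inC/subfield1.
elim/big_ind: _ => [|p q|i _]; [by apply/coefs_inC/subfield1 | exact: coefs_inM |].
move=> k; rewrite !mxE coefB; apply: subfieldB => //; last exact/coefs_inC.
by rewrite coefMn coefX; case: eqP; case: eqP; rewrite ?mulr0n ?mulr1n ?mul0rn ?subfield0 ?subfield1.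
Qed.

End SubfieldDet.

Section GaloisAction.

Variables (K L : fieldType) (iota : {rmorphism K -> L}).
Variables (gT : finGroupType) (G : {group gT}) (act : gT -> {rmorphism L -> L}).

Definition field_action :=
  [/\ forall z, act 1%g z = z,
      forall g h, g \in G -> h \in G -> forall z, act (g * h)%g z = act g (act h z) &
      forall g a, g \in G -> act g (iota a) = iota a].

Definition stable_subfield (F : {pred L}) :=
  [/\ divring_closed F, contains_ground iota F &
      forall g z, g \in G -> z \in F -> act g z \in F].

Definition faithful_on (F : {pred L}) :=
  forall g, g \in G -> (forall z, z \in F -> act g z = z) -> g = 1%g.

(** The essential dimension of G, computed in L, is at most d. *)
Definition ed_le d := exists F : {pred L},
  [/\ stable_subfield F, faithful_on F & trdeg_le iota F d].

Definition fixed : {pred L} := [pred z | [forall (g | g \in G), act g z == z]].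

Lemma fixedP z : reflect (forall g, g \in G -> act g z = z) (z \in fixed).
Proof.
apply: (iffP forallP) => [H g gG|H g]; first by have /implyP/(_ gG)/eqP := H g.
by apply/implyP => gG; rewrite H.
Qed.

Hypothesis actP : field_action.

Let act1 z : act 1%g z = z. Proof. by case: actP. Qed.
Let actM g h z : g \in G -> h \in G -> act (g * h)%g z = act g (act h z).
Proof. by move=> gG hG; case: actP => _ ->. Qed.
Let actK g a : g \in G -> act g (iota a) = iota a. Proof. by case: actP => _ _; apply. Qed.

Lemma divring_closed_fixed : divring_closed fixed.
Proof.
split=> [|u v /fixedP uF /fixedP vF|u v /fixedP uF /fixedP vF]; apply/fixedP => g gG.
- exact: rmorph1.
- by rewrite rmorphB uF ?vF.
- by rewrite fmorph_div uF ?vF.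
Qed.

Lemma fixed_ground : contains_ground iota fixed.
Proof. by move=> a; apply/fixedP => g gG; apply: actK. Qed.

Section Coordinates.

Variable F : {pred L}.
Hypotheses (F_stable : stable_subfield F) (F_faithful : faithful_on F).

Let cF : divring_closed F. Proof. by case: F_stable. Qed.
Let FG g z : g \in G -> z \in F -> act g z \in F. Proof. by case: F_stable => _ _; apply. Qed.

(** Functions on G of the form g |-> \sum_i c_i g(b_i) with b_i in F. *)
Definition conj_comb (u : gT -> L) := exists s : seq (L * L),
  (forall z, z \in s -> z.2 \in F) /\
  (forall g, g \in G -> u g = \sum_(z <- s) z.1 * act g z.2).

Lemma conj_comb_lin c b : b \in F -> conj_comb (fun g => c * (act g b)).
Proof.
move=> bF; exists [:: (c, b)]; split=> [z|g _]; first by rewrite inE => /eqP ->.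
by rewrite big_seq1.
Qed.

Lemma conj_combD u v : conj_comb u -> conj_comb v -> conj_comb (fun g => u g + v g).
Proof.
move=> [s [sF sE]] [t [tF tE]]; exists (s ++ t); split=> [z|g gG].
  by rewrite mem_cat => /orP[/sF|/tF].
by rewrite big_cat sE ?tE.
Qed.

(** Closure under products is where g being multiplicative enters; with it
    delta functions can be written as products of differences. *)
Lemma conj_combM u v : conj_comb u -> conj_comb v -> conj_comb (fun g => u g * v g).
Proof.
move=> [s [sF sE]] [t [tF tE]].
exists [seq (z.1 * w.1, z.2 * w.2) | z <- s, w <- t]; split=> [z|g gG].
  by case/allpairsP => -[a b] /= [aS bT ->] /=; apply: subfieldM; [|apply: sF|apply: tF].
rewrite big_allpairs_dep sE // tE // mulr_suml; apply: eq_bigr => z _.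
by rewrite mulr_sumr; apply: eq_bigr => w _; rewrite /= rmorphM mulrACA.
Qed.

Lemma conj_comb_prod (r : seq gT) (u : gT -> gT -> L) :
  (forall h, conj_comb (u h)) -> conj_comb (fun g => \prod_(h <- r) u h g).
Proof.
move=> uC; elim: r => [|h r IH].
  have [s [sF sE]] := conj_comb_lin 1 (subfield1 cF).
  exists s; split=> // g gG; rewrite -sE // big_nil rmorph1 mulr1 //.
have [s [sF sE]] := conj_combM (uC h) IH.
by exists s; split=> // g gG; rewrite -sE // big_cons.
Qed.

(** The delta function at 1 is the product, over the h != 1 in G, of
    (h(t_h) - g(t_h)) / (h(t_h) - t_h), where t_h in F is moved by h: the
    factor of h vanishes at g = h and all factors are 1 at g = 1. *)
Lemma galois_coordinates : exists s : seq (L * L),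
  (forall z, z \in s -> z.2 \in F) /\
  (forall g, g \in G -> \sum_(z <- s) z.1 * act g z.2 = (g == 1%g)%:R).
Proof.
have : forall h, exists t, t \in F /\ (h \in G -> h != 1%g -> act h t != t).
  move=> h; have [/andP[hG h1]|] := boolP ((h \in G) && (h != 1%g)); last first.
    rewrite negb_and => hn; exists 1; split=> [|hG h1]; first exact: subfield1.
    by move: hn; rewrite hG h1.
  have [t [tF tn]] : exists t, t \in F /\ act h t <> t.
    apply: contrapT => /forallNP H; case/eqP: h1; apply: F_faithful => // z zF.
    by apply: contrapT => n; apply: (H z).
  by exists t; split=> // _ _; apply/eqP.
move=> /choice [th thP].
pose u h g := if (h \in G) && (h != 1%g) then
  (act h (th h) - act g (th h)) / (act h (th h) - th h) else 1.
have /(conj_comb_prod (enum G)) [s [sF sE]] : forall h, conj_comb (u h).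
  move=> h; rewrite /u; case: ((h \in G) && (h != 1%g)).
    pose w := (act h (th h) - th h)^-1.
    have := conj_combD (conj_comb_lin (act h (th h) * w) (subfield1 cF))
                       (conj_comb_lin (- w) (thP h).1).
    move=> [s [sF sE]]; exists s; split=> // g gG; rewrite -sE // rmorph1 mulr1 mulNr.
    by rewrite [w * _]mulrC -mulrBl.
  have [s [sF sE]] := conj_comb_lin 1 (subfield1 cF).
  exists s; split=> // g gG; rewrite -sE // rmorph1 mulr1 //.
exists s; split=> // g gG; rewrite -sE //; case: eqP => [->|/eqP g1].
  rewrite big1 // => h _; rewrite /u; case: ifP => // /andP[hG h1].
  by rewrite act1 divff // subr_eq0 (thP h).2.
rewrite (bigD1_seq g) ?mem_enum ?enum_uniq //= {1}/u gG g1 subrr mul0r.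
by rewrite mul0r.
Qed.

Local Notation m := #|G|.
Local Notation gi := (@enum_val _ (mem G)).

(** By [galois_coordinates] the matrix of all g(b_i) has a left inverse, hence
    maximal rank, and a square invertible submatrix. *)
Lemma conj_matrix_unit : exists2 b : 'I_m -> L, forall i, b i \in F &
  \matrix_(i < m, j < m) act (gi j) (b i) \in unitmx.
Proof.
have [s [sF sE]] := galois_coordinates.
pose r := size s; pose c i := (nth (0, 0) s i).1; pose b i := (nth (0, 0) s i).2.
pose B := \matrix_(i < r, j < m) act (gi j) (b i).
pose C := \matrix_(j < m, i < r) act (gi j) (c i).
(* entry (j, j') is the image under g_j of the relation at g_j^-1 g_j' *)
have CB : C *m B = 1%:M.
  apply/matrixP => j j'; rewrite !mxE.
  under eq_bigr => i _.
    rewrite !mxE.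
    have -> : act (gi j') (b i) = act (gi j) (act ((gi j)^-1 * gi j')%g (b i)).
      by rewrite -actM ?mulKVg ?groupM ?groupV ?enum_valP.
    rewrite -rmorphM; over.
  rewrite -rmorph_sum; have := sE ((gi j)^-1 * gi j')%g.
  rewrite groupM ?groupV ?enum_valP // => /(_ isT).
  rewrite (big_nth (0, 0)) big_mkord => ->; rewrite rmorph_nat.
  by rewrite -eq_mulVg1 (inj_eq enum_val_inj).
have Bfull : row_full B by apply/row_fullP; exists C.
exists (fun i => b (fullrankfun Bfull i)).
  by move=> i; apply/sF/mem_nth.
have := fullrowsub_unit Bfull; congr (is_true (_ \in unitmx)).
by apply/matrixP => i j; rewrite !mxE.
Qed.

End Coordinates.

Section FixedBasis.

Local Notation m := #|G|.
Variable b : 'I_m -> L.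
Local Notation gi := (@enum_val _ (mem G)).
Let N := \matrix_(i < m, j < m) act (gi j) (b i).
Hypothesis N_unit : N \in unitmx.

(** One family b serves both F over its fixed field and L over that of L, so
    the two degrees agree and L is generated by F and the fixed field. *)
Lemma conj_matrix_basis (F : {pred L}) : stable_subfield F ->
  (forall i, b i \in F) -> is_basis [predI F & fixed] F b.
Proof.
move=> [cF KF FG] bF; split=> // x xF.
pose X := \row_(j < m) act (gi j) x; pose c := X *m invmx N.
have cN : c *m N = X by rewrite mulmxKV.
have cF' i : c 0 i \in F.
  rewrite mxE; apply: subfield_sum => // j _; apply: subfieldM => //.
    by rewrite mxE; apply: FG => //; apply: enum_valP.
  by apply: subfield_invmx => // k l; rewrite mxE; apply: FG => //; apply: enum_valP.
have conj_c j : \sum_i c 0 i * act (gi j) (b i) = act (gi j) x.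
  have /rowP/(_ j) := cN; rewrite !mxE => <-.
  by apply: eq_bigr => i _; rewrite !mxE.
have conj_cg g : g \in G -> \sum_i c 0 i * act g (b i) = act g x.
  by move=> gG; have := conj_c (enum_rank_in gG g); rewrite enum_rankK_in.
(* g permutes the equations that determine c *)
have cfix i : c 0 i \in fixed.
  apply/fixedP => g gG; pose cg := map_mx (act g) c.
  suff /(can_inj (mulmxK N_unit)) E : cg *m N = c *m N by move/rowP/(_ i): E; rewrite mxE.
  rewrite cN; apply/rowP => j; rewrite !mxE.
  have jG : gi j \in G by apply: enum_valP.
  transitivity (act g (\sum_i c 0 i * act (g^-1 * gi j)%g (b i))).
    rewrite rmorph_sum; apply: eq_bigr => k _; rewrite !mxE rmorphM -actM ?groupM ?groupV //.
    by rewrite mulKVg.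
  by rewrite conj_cg ?groupM ?groupV // -actM ?groupM ?groupV // mulKVg.
exists [ffun i => c 0 i]; split=> [|c' [c'F xE]].
  split=> [i|]; first by rewrite ffunE; apply/andP; split; [exact: cF' | exact: cfix].
  have := conj_cg _ (group1 G); rewrite act1 => <-.
  by apply: eq_bigr => i _; rewrite ffunE act1.
apply/ffunP => i; rewrite ffunE.
suff /(can_inj (mulmxK N_unit)) E : c *m N = (\row_i c' i) *m N by rewrite E mxE.
rewrite cN; apply/rowP => j; rewrite !mxE xE rmorph_sum; apply: eq_bigr => k _.
rewrite !mxE rmorphM; congr (_ * _).
by have /andP[_ /fixedP -> //] := c'F k; apply: enum_valP.
Qed.

End FixedBasis.

Lemma stable_predT : stable_subfield predT.
Proof. by split. Qed.

Lemma defined_over_fixed (F : {pred L}) : stable_subfield F -> faithful_on F ->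
  defined_over iota fixed [predI F & fixed].
Proof.
move=> Fs Ff; have [cF KF FG] := Fs; have cfx := divring_closed_fixed.
split=> [|a||].
- split=> [|u v /andP[uF ux] /andP[vF vx]|u v /andP[uF ux] /andP[vF vx]]; apply/andP; split.
  + exact: subfield1.
  + exact: subfield1.
  + exact: subfieldB.
  + exact: subfieldB.
  + exact: subfield_div.
  + exact: subfield_div.
- by apply/andP; split; [exact: KF | exact: fixed_ground].
- by move=> z /andP[].
have [b bF bU] := conj_matrix_unit Fs Ff.
have bas := conj_matrix_basis bU Fs bF.
have [_ basT] := conj_matrix_basis bU stable_predT (fun=> isT).
exists F; split=> //.
- by move=> z /andP[].
- exists #|G|; split; first by exists b.
  by exists b; split.
move=> M cM FM xM x; have [c [[cx ->] _]] := basT x isT.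
by apply: subfield_sum => // i _; apply: subfieldM => //; [apply/xM/cx | apply/FM].
Qed.

(** The intersection of the conjugates of A. *)
Lemma stable_core (A : {pred L}) : divring_closed A -> contains_ground iota A ->
  exists F : {pred L}, [/\ stable_subfield F, {subset F <= A} &
    forall z, (forall g, g \in G -> act g z \in A) -> z \in F].
Proof.
move=> cA KA; pose F : {pred L} := [pred z | [forall (g | g \in G), act g z \in A]].
have FP z : reflect (forall g, g \in G -> act g z \in A) (z \in F).
  apply: (iffP forallP) => [H g gG|H g]; first by have /implyP/(_ gG) := H g.
  by apply/implyP => gG; apply: H.
exists F; split=> [|z /FP /(_ 1%g)|z zA]; last exact/FP; last by rewrite act1; apply.
split=> [|a|g z gG /FP zF].
- split=> [|u v /FP uF /FP vF|u v /FP uF /FP vF]; apply/FP => g gG.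
  + by rewrite rmorph1 subfield1.
  + by rewrite rmorphB subfieldB ?uF ?vF.
  + by rewrite fmorph_div subfield_div ?uF ?vF.
- by apply/FP => g gG; rewrite actK.
- by apply/FP => h hG; rewrite -actM // zF ?groupM.
Qed.

(** The field E in the definition need not be stable, but its elements are
    roots of polynomials over E0, which G fixes; so their conjugates are
    algebraic over E0 as well.  Faithfulness holds because an automorphism
    trivial on E and on the fixed field is trivial on their compositum. *)
Lemma defined_over_ed_le (E0 : {pred L}) e : faithful_on predT ->
  defined_over iota fixed E0 -> trdeg_le iota E0 e -> ed_le e.
Proof.
move=> Lf [cE0 KE0 E0x [E [cE E0E [m [[b [bE bP]] _]] comp]]] /algebraic_hull [A [Acl E0A Ae]].
have [cA KA Aroot] := Acl; have [F [Fs FA AF]] := stable_core cA KA.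
have EF z : z \in E -> z \in F.
  move=> zE; apply: AF => g gG.
  have /fin_all_exists [a aP] : forall i, exists a : {ffun 'I_m -> L},
      (forall j, a j \in E0) /\ z * b i = \sum_j a j * b j.
    move=> i; have [|a [H _]] := bP (z * b i); last by exists a.
    exact: subfieldM.
  (* z is an eigenvalue of the matrix over E0 of the multiplication by z *)
  pose M := \matrix_(j, i) a i j.
  have zM : root (char_poly M) z.
    rewrite -eigenvalue_root_char; apply/eigenvalueP; exists (\row_i b i).
      apply/rowP => i; rewrite !mxE (aP i).2; apply: eq_bigr => j _.
      by rewrite !mxE mulrC.
    apply/eqP => /rowP b0; have [c [[_ E1] _]] := bP 1 (subfield1 cE).
    case/eqP: (oner_neq0 L); rewrite E1 big1 // => i _.
    by have := b0 i; rewrite !mxE => ->; rewrite mulr0.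
  have Mco : coefs_in E0 (char_poly M).
    by apply: coefs_in_char_poly => // j i; rewrite mxE; apply: (aP i).1.
  apply: (Aroot (char_poly M)) => [||i]; last exact/E0A/Mco.
    exact/monic_neq0/char_poly_monic.
  have -> : char_poly M = map_poly (act g) (char_poly M).
    apply/polyP => i; rewrite coef_map.
    by have /fixedP/(_ g gG) := E0x _ (Mco i) => /esym.
  exact: rmorph_root.
exists F; split=> //; last exact: trdeg_leS FA Ae.
move=> g gG gF; apply: Lf => // z _.
pose M : {pred L} := [pred z | act g z == z].
suff : z \in M by move/eqP.
apply: (comp M) => [|u uE|u ux].
- split=> [|u v /eqP uF /eqP vF|u v /eqP uF /eqP vF]; apply/eqP.
  + exact: rmorph1.
  + by rewrite rmorphB uF vF.
  + by rewrite fmorph_div uF vF.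
- exact/eqP/gF/EF.
- by apply/eqP; move/fixedP: ux; apply.
Qed.

Lemma is_ed_fixed d : faithful_on predT ->
  ed_le d -> (forall e, ed_le e -> (d <= e)%N) -> is_ed iota fixed d.
Proof.
move=> Lf [F [Fs Ff Fd]] dmin; split; last first.
  by move=> E0 e E0d [_ E0e]; apply/dmin/(defined_over_ed_le Lf E0d).
have E0d := defined_over_fixed Fs Ff; exists ([predI F & fixed] : {pred L}) => //.
have E0e : trdeg_le iota [predI F & fixed] d by apply: trdeg_leS Fd => z /andP[].
have [s sd Es] := trdeg_le_has_trdeg E0e.
suff -> : d = s by [].
apply/eqP; rewrite eqn_leq sd andbT; apply: dmin.
by apply: defined_over_ed_le Lf E0d _; case: Es.
Qed.

Lemma ed_le_mon d e : (d <= e)%N -> ed_le d -> ed_le e.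
Proof. by move=> de [F [Fs Ff Fd]]; exists F; split=> //; apply: trdeg_le_mon Fd. Qed.

End GaloisAction.

Lemma ed_le_eq_act (K L : fieldType) (iota : {rmorphism K -> L}) (gT : finGroupType)
    (G : {group gT}) (act1 act2 : gT -> {rmorphism L -> L}) d :
  (forall g u, g \in G -> act1 g u = act2 g u) ->
  ed_le iota G act1 d -> ed_le iota G act2 d.
Proof.
move=> E [F [[cF KF FG] Ff Fd]]; exists F; split=> //.
  by split=> // g u gG uF; rewrite -E //; apply: FG.
by move=> g gG gF; apply: Ff => // u uF; rewrite E // gF.
Qed.

(** * Places and their images *)

Section Place.

Variables (K L1 L2 : fieldType) (iota1 : {rmorphism K -> L1}) (iota2 : {rmorphism K -> L2}).

(** A K-place from L1 to L2, given by its graph on the elements where it is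
    defined. *)
Record is_place (R : L1 -> L2 -> Prop) : Prop := IsPlace {
  placeC : forall a, R (iota1 a) (iota2 a);
  placeD : forall u v x y, R u x -> R v y -> R (u + v) (x + y);
  placeM : forall u v x y, R u x -> R v y -> R (u * v) (x * y);
  place0 : forall x, R 0 x -> x = 0;
  placeV : forall u x, R u x -> x != 0 -> R u^-1 x^-1
}.

Variable R : L1 -> L2 -> Prop.
Hypothesis R_place : is_place R.

Lemma place00 : R 0 0. Proof. by have := placeC R_place 0; rewrite !rmorph0. Qed.
Lemma place11 : R 1 1. Proof. by have := placeC R_place 1; rewrite !rmorph1. Qed.

Lemma placeN u x : R u x -> R (- u) (- x).
Proof.
move=> Rux; rewrite -[- u]mulN1r -[- x]mulN1r; apply: (placeM R_place) => //.
by have := placeC R_place (-1); rewrite !rmorphN !rmorph1.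
Qed.

Lemma placeB u v x y : R u x -> R v y -> R (u - v) (x - y).
Proof. by move=> Rux Rvy; apply: (placeD R_place) => //; apply: placeN. Qed.

Lemma place_uniq u x y : R u x -> R u y -> x = y.
Proof.
move=> Rux Ruy; apply/eqP; rewrite -subr_eq0; apply/eqP/(place0 R_place).
by rewrite -(subrr u); apply: placeB.
Qed.

Lemma placeX n u x : R u x -> R (u ^+ n) (x ^+ n).
Proof.
move=> Rux; elim: n => [|n IH]; first by rewrite !expr0; apply: place11.
by rewrite !exprS; apply: (placeM R_place).
Qed.

Lemma place_mmap m (u : 'I_m -> L1) (x : 'I_m -> L2) p :
  (forall i, R (u i) (x i)) -> R (mmap iota1 u p) (mmap iota2 x p).
Proof.
move=> Rux; apply: (big_ind2 R); [exact: place00 | by move=> *; apply: (placeD R_place) |] => mon _.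
apply: (placeM R_place) => //; first exact: (placeC R_place).
by apply: (big_ind2 R); [exact: place11 | by move=> *; apply: (placeM R_place) | move=> i _; apply: placeX].
Qed.

(** A relation between the u i specializes to one between their images. *)
Lemma place_alg_independent m (u : 'I_m -> L1) (x : 'I_m -> L2) :
  (forall i, R (u i) (x i)) -> alg_independent iota2 x -> alg_independent iota1 u.
Proof.
move=> Rux xi p up0; apply: xi; apply: (place0 R_place).
by rewrite -up0; apply: place_mmap.
Qed.

Definition place_image (F : {pred L1}) : {pred L2} :=
  [pred x | `[< exists2 u, u \in F & R u x >]].

Lemma place_imageP (F : {pred L1}) x :
  reflect (exists2 u, u \in F & R u x) (x \in place_image F).
Proof. exact: asboolP. Qed.

Lemma trdeg_le_place_image F d :
  trdeg_le iota1 F d -> trdeg_le iota2 (place_image F) d.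
Proof.
move=> Fd m x xF xi.
have /fin_all_exists [u uP] : forall i, exists u, u \in F /\ R u (x i).
  by move=> i; have /place_imageP [u uF Ru] := xF i; exists u.
by apply: (Fd m u) => [i|]; [case: (uP i) | apply: place_alg_independent xi => i; case: (uP i)].
Qed.

Variables (gT : finGroupType) (G : {group gT}).
Variables (act1 : gT -> {rmorphism L1 -> L1}) (act2 : gT -> {rmorphism L2 -> L2}).
Hypothesis R_equi : forall g u x, g \in G -> R u x -> R (act1 g u) (act2 g x).

(** The image is a field because an element with nonzero image has an inverse
    on which the place is defined. *)
Lemma stable_place_image F : stable_subfield iota1 G act1 F ->
  stable_subfield iota2 G act2 (place_image F).
Proof.
move=> [cF KF FG]; split=> [|a|g x gG /place_imageP [u uF Rux]].
- split=> [|x y /place_imageP [u uF Rux] /place_imageP [v vF Rvy]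
          |x y /place_imageP [u uF Rux] /place_imageP [v vF Rvy]]; apply/place_imageP.
  + by exists 1; [apply: subfield1 | apply: place11].
  + by exists (u - v); [apply: subfieldB | apply: placeB].
  + have [->|y0] := eqVneq y 0.
      by rewrite invr0 mulr0; exists 0; [apply: subfield0 | apply: place00].
    exists (u / v); first exact: subfield_div.
    by apply: (placeM R_place) => //; apply: (placeV R_place).
- by apply/place_imageP; exists (iota1 a) => //; apply: (placeC R_place).
- by apply/place_imageP; exists (act1 g u); [apply: FG | apply: R_equi].
Qed.

End Place.

Lemma frac_place_is_place (K : fieldType) (R : idomainType) (E : fieldType)
    (iR : {rmorphism K -> R}) (i1 : {rmorphism K -> {fraction R}}) (i2 : {rmorphism K -> E})
    (f : {rmorphism R -> E}) :
  (forall a, i1 a = (iR a)%:F) -> (forall a, f (iR a) = i2 a) ->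
  is_place i1 i2 (frac_place f).
Proof.
move=> i1E fE; split.
- by move=> a; rewrite i1E -fE; apply: frac_placeF.
- exact: frac_placeD.
- exact: frac_placeM.
- exact: frac_place0.
- exact: frac_placeV.
Qed.

Lemma linear_poly_root (F : fieldType) (a b : F) : b != 0 ->
  b%:P * 'X - a%:P != 0 /\ root (b%:P * 'X - a%:P) (a / b).
Proof.
move=> b0; split; last first.
  by rewrite /root hornerD hornerN hornerM !hornerC hornerX mulrC divfK // subrr.
apply/eqP => /(congr1 (fun p : {poly F} => p`_1)).
by rewrite coef0 coefB coefMX !coefC /= subr0 => /eqP; rewrite (negPf b0).
Qed.

(** * The action of G on K(V) *)

Section RepresentationField.

Variables (K : fieldType) (gT : finGroupType) (G : {group gT}) (n : nat).
Variable rG : mx_representation K G n.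

Local Notation "'ratfun'" := {fraction {mpoly K[n]}}.

(** For g outside G the matrix rG g may be singular; replacing g by 1 there
    makes every [rep_act g] a ring morphism. *)
Definition to_group (g : gT) := if g \in G then g else 1%g.

Lemma to_group_in g : to_group g \in G.
Proof. by rewrite /to_group; case: ifP. Qed.

Definition rep_act_poly (g : gT) : {rmorphism {mpoly K[n]} -> ratfun} :=
  @tofrac _ \o comp_mpoly [tuple \sum_(j < n) rG ((to_group g)^-1)%g i j *: 'X_j | i < n].

Lemma rep_act_polyE g p : rep_act_poly g p = (poly_act rG (to_group g) p)%:F.
Proof. by []. Qed.

Lemma rep_act_poly_inj g : injective (rep_act_poly g).
Proof.
apply: raddf_inj => p p0; apply/eqP.
by rewrite -(poly_act_eq0 rG _ (to_group_in g)) -tofrac_eq0; apply/eqP.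
Qed.

(** Locked to keep conversion from unfolding the construction of the fraction
    field. *)
Definition rep_act (g : gT) : {rmorphism ratfun -> ratfun} :=
  locked (frac_lift (@rep_act_poly_inj g) : {rmorphism _ -> _}).

Lemma rep_act_unlock g u : rep_act g u = frac_lift (@rep_act_poly_inj g) u.
Proof. by rewrite /rep_act -lock. Qed.

Lemma rep_act_frac g a b : g \in G -> b != 0 ->
  rep_act g (a%:F / b%:F) = (poly_act rG g a)%:F / (poly_act rG g b)%:F.
Proof.
move=> gG b0; have := frac_liftE (@rep_act_poly_inj g) a b0; rewrite -rep_act_unlock.
by rewrite !rep_act_polyE /to_group gG.
Qed.

Lemma rep_actF g a : g \in G -> rep_act g a%:F = (poly_act rG g a)%:F.
Proof.
move=> gG; have := frac_liftF (@rep_act_poly_inj g) a; rewrite -rep_act_unlock.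
by rewrite rep_act_polyE /to_group gG.
Qed.

Lemma rep_actE g u : g \in G -> rep_act g u = ratfun_act rG g u.
Proof.
by move=> gG; rewrite {1}(ratfun_numden u) (rep_act_frac _ gG (denom_ratioP _)).
Qed.

Lemma fixed_fieldE : fixed_field rG = fixed G rep_act.
Proof.
apply/funext => u; apply/idP/idP => [/forallP H|/fixedP H].
  by apply/fixedP => g gG; rewrite rep_actE //; have /implyP/(_ gG)/eqP := H g.
by apply/forallP => g; apply/implyP => gG; rewrite -rep_actE // H.
Qed.

Lemma rep_act_field_action : field_action (@ratfunC K n) G rep_act.
Proof.
split=> [z|g h gG hG z|g a gG].
- have [a [b [b0 ->]]] := frac_numden z.
  by rewrite (rep_act_frac _ (group1 G) b0) !poly_act1.
- have [a [b [b0 ->]]] := frac_numden z.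
  have hb0 : poly_act rG h b != 0 by rewrite poly_act_eq0.
  apply: etrans (rep_act_frac a (groupM gG hG) b0) _; apply: esym.
  apply: etrans (congr1 (rep_act g) (rep_act_frac a hG b0)) _.
  apply: etrans (rep_act_frac _ gG hb0) _.
  by rewrite -!(poly_act_comp rG _ gG hG).
by rewrite /= /ratfunC (rep_actF _ gG) /poly_act comp_mpolyC.
Qed.

Lemma poly_actX g i : poly_act rG g 'X_i = \sum_(j < n) rG g^-1%g i j *: 'X_j.
Proof. by rewrite /poly_act comp_mpolyXU -tnth_nth tnth_mktuple. Qed.

Lemma rep_act_fix g : g \in G -> (forall u, rep_act g u = u) -> rG g = 1%:M.
Proof.
move=> gG fixg; suff E : rG g^-1%g = 1%:M.
  by rewrite -[rG g]mulmx1 -E -repr_mxM ?groupV // mulgV repr_mx1.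
apply/matrixP => i j; have := fixg ('X_i)%:F; rewrite (rep_actF _ gG) => /eqP.
rewrite tofrac_eq poly_actX => /eqP /(congr1 (mcoeff U_(j))).
rewrite raddf_sum (bigD1 j) //= mcoeffZ !mcoeffX eqxx mulr1 big1 ?addr0.
  by move=> ->; rewrite mxE eq_mnm1.
by move=> k /negPf kj; rewrite mcoeffZ mcoeffX eq_mnm1 kj mulr0.
Qed.

Lemma rep_act_faithful : mx_faithful rG -> faithful_on G rep_act predT.
Proof.
move=> ff g gG fixg; apply/set1gP; apply: (subsetP ff); apply/rkerP; split=> //.
by apply: rep_act_fix => // u; apply: fixg.
Qed.

Lemma mmap_ratfun (p : {mpoly K[n]}) : mmap (@ratfunC K n) (fun i => ('X_i)%:F) p = p%:F.
Proof.
pose f : {rmorphism _ -> _} := mmap (@ratfunC K n) (fun i => ('X_i)%:F).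
apply: (@mpoly_rmorph_ext _ _ _ f (@tofrac _)) => [c|i] /=; first by rewrite mmapC.
by rewrite mmapX mmap1U.
Qed.

Lemma trdeg_le_ratfun : trdeg_le (@ratfunC K n) predT n.
Proof.
move=> m y _; apply: (@algebraic_family_bound _ _ _ _ _ (fun i => ('X_i)%:F)) => i.
have [a [b [b0 ->]]] := frac_numden (y i).
exists (b%:P * 'X - a%:P).
have -> : map_poly (mmap (@ratfunC K n) (fun i => ('X_i)%:F)) (b%:P * 'X - a%:P) =
   (b%:F)%:P * 'X - (a%:F)%:P.
  by rewrite rmorphB rmorphM /= !map_polyC map_polyX /= !mmap_ratfun.
apply: linear_poly_root; by rewrite tofrac_eq0.
Qed.

Lemma ratfun_ed_le : mx_faithful rG -> ed_le (@ratfunC K n) G rep_act n.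
Proof.
move=> ff; exists (predT : {pred ratfun}); split; first exact: stable_predT.
  exact: rep_act_faithful.
exact: trdeg_le_ratfun.
Qed.

(** Fixed elements of infinite multiplicative order provide infinitely many
    fixed elements, also over a finite field K. *)
Definition infinite_order (L : fieldType) (z : L) := injective (fun k : nat => z ^+ k).

(** The norm of a coordinate: a polynomial that vanishes at 0 and hence is
    not a root of unity. *)
Lemma ratfun_fixed_infinite (i0 : 'I_n) :
  exists2 z, z \in fixed G rep_act & infinite_order z.
Proof.
pose N := \prod_(g in G) poly_act rG g 'X_i0.
have N0 : mmap idfun (fun=> 0) N = 0.
  rewrite /N rmorph_prod /= (bigD1 1%g) //= poly_act1 mmapX mmap1U mul0r //.
have Nn0 : N != 0.
  by apply/prodf_neq0 => g gG; rewrite poly_act_eq0 // -msupp_eq0 msuppX.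
exists N%:F.
  apply/fixedP => h hG; rewrite (rep_actF _ hG); congr (_%:F).
  rewrite /poly_act rmorph_prod [RHS](reindex_inj (mulgI h)) /=.
  apply: eq_big => [g|g gG]; first by rewrite groupMl.
  by rewrite (poly_act_comp rG _ hG gG).
have pow_neq1 k : N ^+ k.+1 != 1.
  apply/eqP => /(congr1 (mmap idfun (fun=> 0))) /=.
  by rewrite rmorph1 rmorphXn /= N0 exprS mul0r => /esym/eqP; rewrite oner_eq0.
have lt_neq i j : (i < j)%N -> N%:F ^+ i != N%:F ^+ j.
  move=> lt; rewrite -!rmorphXn tofrac_eq -(subnK lt) addnS -addSn addnC exprD.
  rewrite -[X in X != _]mulr1 (inj_eq (mulfI (expf_neq0 _ Nn0))) eq_sym.
  exact: pow_neq1.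
move=> i j /= E; case: (ltngtP i j) => // lt; have := lt_neq _ _ lt; rewrite E eqxx //.
Qed.

End RepresentationField.

(** * Equivariant points and the transfer of essential dimension *)

Lemma mpoly_nonvanishing (L : fieldType) (S : nat -> L) m (q : {mpoly L[m]}) :
  injective S -> q != 0 -> exists e : 'I_m -> nat, mmap idfun (fun i => S (e i)) q != 0.
Proof.
move=> S_inj; elim: m q => [|m IH] q q0.
  exists (fun=> 0%N); rewrite (mpoly_ord0_const q) mmapC /=.
  by apply: contraNneq q0 => E0; rewrite (mpoly_ord0_const q) E0 mpolyC0.
have mq0 : muni q != 0 by rewrite -(rmorph0 (@muni m L)) (inj_eq (@muni_inj _ _)).
have /IH [e e0] : lead_coef (muni q) != 0 by rewrite lead_coef_eq0.
pose p := map_poly (mmap idfun (fun i => S (e i))) (muni q).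
have p0 : p != 0.
  apply: contraNneq e0 => p0; rewrite lead_coefE.
  have := coef_map (mmap idfun (fun i => S (e i))) (muni q) (size (muni q)).-1.
  by rewrite -/p p0 coef0 => <-.
have [k kP] : exists k, ~~ root p (S k).
  apply: contrapT => /forallNP H.
  have := max_poly_roots p0 (rs := [seq S k | k <- iota 0 (size p)]).
  rewrite size_map size_iota ltnn => /(_ _ _)/negP; apply => //.
    by apply/allP => _ /mapP [k _ ->]; apply/negPn/negP/H.
  by rewrite map_inj_uniq ?iota_uniq.
exists (fam_rcons e k).
have -> : (fun i => S (fam_rcons e k i)) = fam_rcons (fun i => S (e i)) (S k).
  by apply/funext => i; rewrite /fam_rcons; case: unlift.
by rewrite (mmap_fam_rcons idfun).
Qed.

Section Covariants.

Variables (K L : fieldType) (iota : {rmorphism K -> L}).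
Variables (gT : finGroupType) (G : {group gT}) (act : gT -> {rmorphism L -> L}).
Hypothesis actP : field_action iota G act.
Hypothesis act_faithful : faithful_on G act predT.
Variable z : L.
Hypotheses (z_fixed : z \in fixed G act) (z_infinite : infinite_order z).
Variables (n : nat) (rG : mx_representation K G n).

(** phi is a point of V over L such that evaluation of functions at phi
    commutes with G, see [f_equi] in [transfer_stable]. *)
Definition covariant (phi : 'I_n -> L) := forall g i, g \in G ->
  act g (phi i) = \sum_j iota (rG g^-1%g i j) * phi j.

(** Coordinate l of the trace over G of b times the basis vector k of V. *)
Definition covariant_trace (b : L) (k : 'I_n) (l : 'I_n) : L :=
  \sum_(h in G) act h b * iota (rG h l k).

Lemma covariant_covariant_trace b k : covariant (covariant_trace b k).
Proof.
case: actP => _ actM actK g l gG; rewrite /covariant_trace rmorph_sum.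
under [RHS]eq_bigr => j _ do rewrite mulr_sumr.
rewrite exchange_big [RHS](reindex_inj (mulgI g)) /=.
apply: eq_big => [h|h hG]; first by rewrite groupMl.
rewrite rmorphM actK //.
have -> : rG h = rG g^-1%g *m rG (g * h)%g.
  by rewrite -repr_mxM ?groupV ?groupM // mulKg.
rewrite mxE rmorph_sum mulr_sumr; apply: eq_bigr => j _.
by rewrite rmorphM mulrCA actM.
Qed.

(** Linear combinations of traces with coefficients in the fixed field are
    covariant.  With coefficients in L they fill all of L^n, by
    [galois_coordinates], so D is not identically zero on them, and it remains
    nonzero for some coefficients taken among the powers of z. *)
Lemma covariant_nonvanishing (D : {mpoly K[n]}) : D != 0 ->
  exists2 phi, covariant phi & mmap iota phi D != 0.
Proof.
move=> D0; have [s [_ sE]] := galois_coordinates actP (stable_predT iota G act) act_faithful.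
pose r := size s; pose c (i : 'I_r) := (nth (0, 0) s i).1; pose b (i : 'I_r) := (nth (0, 0) s i).2.
have sE' g : g \in G -> \sum_(i < r) c i * act g (b i) = (g == 1%g)%:R.
  by move=> /sE; rewrite (big_nth (0, 0)) big_mkord.
pose T : finType := ('I_r * 'I_n)%type; pose m := #|T|.
pose ph (a : 'I_m) l := covariant_trace (b (enum_val a).1) (enum_val a).2 l.
pose phX l : {mpoly L[m]} := \sum_a ph a l *: 'X_a.
pose iC k : {rmorphism K -> {mpoly L[k]}} := @mpolyC k L \o iota.
pose toq : {rmorphism {mpoly K[n]} -> {mpoly L[m]}} := mmap (iC m) phX.
(* substituting the coordinates c recovers the generic point of V, so that
   D may be read off from toq D *)
pose back : {rmorphism {mpoly L[m]} -> {mpoly L[n]}} :=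
  mmap (@mpolyC n L) (fun a => c (enum_val a).1 *: 'X_((enum_val a).2)).
pose mapD : {rmorphism {mpoly K[n]} -> {mpoly L[n]}} := mmap (iC n) (fun i => 'X_i).
have mapD0 : mapD D != 0.
  have -> : mapD D = map_mpoly iota D by [].
  apply: contraNneq D0 => E; apply/eqP/mpolyP => k.
  have /eqP := congr1 (mcoeff k) E.
  by rewrite mcoeff_map_mpoly !mcoeff0 fmorph_eq0 => /eqP.
have q0 : toq D != 0.
  apply: contraNneq mapD0 => E.
  suff <- : back (toq D) = mapD D by rewrite E rmorph0.
  pose f : {rmorphism {mpoly K[n]} -> {mpoly L[n]}} := back \o toq.
  apply: (@mpoly_rmorph_ext _ _ _ f mapD) => [a|l] /=.
    by rewrite /toq /mapD /back /= !mmapC /= ?mmapC.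
  rewrite /toq /mapD /= !mmapX !mmap1U /phX rmorph_sum /=.
  under eq_bigr => a _ do rewrite /back /= mmapZ mmapX mmap1U mul_mpolyC scalerA.
  rewrite (reindex (@enum_rank T)) /=; last first.
    by exists enum_val => a _; rewrite ?enum_valK ?enum_rankK.
  under eq_bigr => a _ do rewrite /ph enum_rankK.
  rewrite -(pair_bigA _ (fun i k => (covariant_trace (b i) k l * c i) *: 'X_k)) /=.
  rewrite exchange_big /= (bigD1 l) //=.
  have colE k : \sum_i (covariant_trace (b i) k l * c i) *: ('X_k : {mpoly L[n]}) =
      (k == l)%:R *: 'X_k.
    rewrite -scaler_suml; congr (_ *: _).
    under eq_bigr => i _ do rewrite /covariant_trace mulr_suml.
    rewrite exchange_big /=.
    transitivity (\sum_(h in G) (h == 1%g)%:R * iota (rG h l k)).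
      apply: eq_bigr => h hG; rewrite -sE' // mulr_suml.
      by apply: eq_bigr => i _; rewrite mulrAC [_ * c i]mulrC.
    rewrite (bigD1 1%g) //= eqxx mul1r repr_mx1 mxE rmorph_nat big1 ?addr0; first by rewrite eq_sym.
    by move=> h /andP[_ /negPf ->]; rewrite mul0r.
  rewrite colE eqxx scale1r big1 ?addr0 // => k /negPf kl.
  by rewrite colE kl scale0r.
have [e e0] := mpoly_nonvanishing z_infinite q0.
pose phi l := \sum_a ph a l * z ^+ e a.
exists phi.
  move=> g i gG; rewrite /phi rmorph_sum.
  under [RHS]eq_bigr => j _ do rewrite mulr_sumr.
  rewrite exchange_big /=; apply: eq_bigr => a _.
  have zE : act g z = z by move/fixedP: z_fixed; apply.
  rewrite rmorphM rmorphXn /= zE covariant_covariant_trace // mulr_suml.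
  by apply: eq_bigr => j _; rewrite mulrA.
suff <- : mmap idfun (fun a => z ^+ e a) (toq D) = mmap iota phi D by [].
pose ev : {rmorphism {mpoly L[m]} -> L} := mmap idfun (fun a => z ^+ e a).
pose f : {rmorphism {mpoly K[n]} -> L} := ev \o toq.
apply: (@mpoly_rmorph_ext _ _ _ f (mmap iota phi)) => [a|l] /=.
  by rewrite /toq /ev /= !mmapC /= ?mmapC.
rewrite /toq /= !mmapX !mmap1U /phX rmorph_sum; apply: eq_bigr => a _.
by rewrite /ev /= mmapZ mmapX mmap1U.
Qed.

(** Elements of G that move F are made to move F' one by one, so that the
    lemma also serves for a representation of a quotient of G. *)
Lemma transfer_stable (F : {pred {fraction {mpoly K[n]}}}) d :
  stable_subfield (@ratfunC K n) G (rep_act rG) F -> trdeg_le (@ratfunC K n) F d ->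
  exists F' : {pred L}, [/\ stable_subfield iota G act F', trdeg_le iota F' d &
    forall g, g \in G -> (forall w, w \in F' -> act g w = w) ->
      forall u, u \in F -> rep_act rG g u = u].
Proof.
move=> Fs Fd.
have : forall g, exists t, t \in F /\
    ((exists2 u, u \in F & rep_act rG g u != u) -> rep_act rG g t != t).
  move=> g; have [[u uF un]|H] := EM (exists2 u, u \in F & rep_act rG g u != u).
    by exists u.
  by exists 0; split=> //; apply: subfield0; case: Fs.
move=> /choice [th thP].
have /choice [nd ndP] : forall u : {fraction {mpoly K[n]}},
    exists nd : {mpoly K[n]} * {mpoly K[n]}, nd.2 != 0 /\ u = nd.1%:F / nd.2%:F.
  by move=> u; have [a [b H]] := frac_numden u; exists (a, b).
pose dl g := rep_act rG g (th g) - th g.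
pose nz (p : {mpoly K[n]}) := if p == 0 then 1 else p.
have nz0 p : nz p != 0 by rewrite /nz; case: (eqVneq p 0) => // _; apply: oner_neq0.
(* Where D does not vanish, th g and th g moved by g are defined and
   have different values; nz discards the zero differences. *)
pose D := \prod_(g in G) ((nd (th g)).2 * (nd (dl g)).2 * nz (nd (dl g)).1).
have D0 : D != 0.
  by apply/prodf_neq0 => g _; rewrite !mulf_neq0 ?nz0 //; case: (ndP (th g)); case: (ndP (dl g)).
have [phi phi_cov phiD] := covariant_nonvanishing D0.
pose f : {rmorphism {mpoly K[n]} -> L} := mmap iota phi.
have fD g : g \in G -> [/\ f (nd (th g)).2 != 0, f (nd (dl g)).2 != 0 & f (nz (nd (dl g)).1) != 0].
  move=> gG; have := phiD; rewrite -/(f D) /D rmorph_prod => /prodf_neq0 /(_ g gG).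
  by rewrite !rmorphM !mulf_eq0 !negb_or => /andP[/andP[]].
have f_equi g p : g \in G -> f (poly_act rG g p) = act g (f p).
  move=> gG; pose f1 : {rmorphism {mpoly K[n]} -> L} :=
    f \o comp_mpoly [tuple \sum_(j < n) rG g^-1%g i j *: 'X_j | i < n].
  pose f2 : {rmorphism {mpoly K[n]} -> L} := act g \o f.
  apply: (@mpoly_rmorph_ext _ _ _ f1 f2) => [c|i] /=.
    rewrite comp_mpolyC /f /= !mmapC; case: actP => _ _ -> //.
  rewrite comp_mpolyXU -tnth_nth tnth_mktuple /f /= mmapX mmap1U phi_cov // raddf_sum.
  by apply: eq_bigr => j _; rewrite /= mmapZ mmapX mmap1U.
pose R := frac_place f.
have R_place : is_place (@ratfunC K n) iota R.
  apply: (@frac_place_is_place _ _ _ (@mpolyC n K)) => // a.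
  by rewrite /f /= mmapC.
have R_equi g u x : g \in G -> R u x -> R (rep_act rG g u) (act g x).
  move=> gG [a [b [b0 -> ->]]].
  have bn0 : b != 0 by apply: contraNneq b0 => ->; rewrite rmorph0.
  exists (poly_act rG g a), (poly_act rG g b); split.
  - by rewrite f_equi // fmorph_eq0.
  - exact: (rep_act_frac rG a gG bn0).
  - by rewrite !f_equi // fmorph_div.
exists (place_image R F); split.
- have := stable_place_image R_place R_equi Fs. apply.
- have := trdeg_le_place_image R_place Fd. apply.
move=> g gG gfix u uF; apply/eqP; apply: contraT => un.
have [thF /(_ (ex_intro2 _ _ u uF un))] := thP g.
have [f1 f2 f3] := fD g gG.
have [_ thE] := ndP (th g); have [_ dlE] := ndP (dl g).
have Rth : R (th g) (f (nd (th g)).1 / f (nd (th g)).2) by exists (nd (th g)).1, (nd (th g)).2.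
have Rdl : R (dl g) (f (nd (dl g)).1 / f (nd (dl g)).2) by exists (nd (dl g)).1, (nd (dl g)).2.
have /gfix gw : f (nd (th g)).1 / f (nd (th g)).2 \in place_image R F.
  by apply/place_imageP; exists (th g).
have := placeB R_place (R_equi g _ _ gG Rth) Rth; rewrite gw subrr => Rdl0.
have := place_uniq R_place Rdl Rdl0 => /eqP.
rewrite mulf_eq0 invr_eq0 (negPf f2) orbF => n0.
have : dl g = 0.
  rewrite dlE; suff -> : (nd (dl g)).1 = 0 by rewrite rmorph0 mul0r.
  by apply/eqP; apply: contraTT f3 => h; rewrite negbK /nz (negPf h).
by move=> /eqP; rewrite subr_eq0 => ->.
Qed.

End Covariants.

Lemma ed_le_transfer (K L : fieldType) (iota : {rmorphism K -> L})
    (gT : finGroupType) (G : {group gT}) (act : gT -> {rmorphism L -> L}) (z : L)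
    (n : nat) (rG : mx_representation K G n) d :
  field_action iota G act -> faithful_on G act predT ->
  z \in fixed G act -> infinite_order z ->
  ed_le (@ratfunC K n) G (rep_act rG) d -> ed_le iota G act d.
Proof.
move=> aP af zf zi [F [Fs Ff Fd]].
have [F' [F's F'd F'f]] := transfer_stable aP af zf zi Fs Fd.
by exists F'; split=> // g gG /(F'f g gG) /(Ff g gG).
Qed.

Lemma ed_le_repr_indep (K : fieldType) (gT : finGroupType) (H : {group gT})
    n1 (r1 : mx_representation K H n1) n2 (r2 : mx_representation K H n2) d :
  mx_faithful r2 -> ed_le (@ratfunC K n1) H (rep_act r1) d ->
  ed_le (@ratfunC K n2) H (rep_act r2) d.
Proof.
(* in dimension 0 the fixed field may be finite, but the bound is trivial *)
case: n2 r2 => [|n2] r2 f2 H1; first exact: ed_le_mon (leq0n d) (ratfun_ed_le f2).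
have [z zf zi] := ratfun_fixed_infinite r2 ord0.
exact: ed_le_transfer (rep_act_field_action r2) (rep_act_faithful f2) zf zi H1.
Qed.

(** * Direct products with a cyclic group and the upper bound *)

Section DirectCyclic.

Variables (gT : finGroupType) (G G' : {group gT}) (sigma : gT).
Hypothesis defG : (G' \x <[sigma]> = G)%g.

Definition dfst (g : gT) : gT := divgr G' <[sigma]> g.
Definition dsnd (g : gT) : gT := remgr G' <[sigma]> g.

Let compl : (<[sigma]>%G \in [complements to G' in G])%g.
Proof. exact/sdprod_compl/dprodWsd. Qed.

Let cG's : <[sigma]>%g \subset 'C(G')%g. Proof. by case/dprodP: defG. Qed.

Let nG' : (G' <| G)%g. Proof. by case/dprod_normal2: defG. Qed.

Lemma dfst_dsnd g : g = (dfst g * dsnd g)%g.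
Proof. exact: divgr_eq. Qed.

Lemma dfst_in g : g \in G -> dfst g \in G'.
Proof. by move=> gG; apply: mem_divgr; rewrite (dprodW defG). Qed.

Lemma dsnd_in g : g \in G -> dsnd g \in <[sigma]>%g.
Proof. by move=> gG; apply: mem_remgr; rewrite (dprodW defG). Qed.

Lemma dfstM : {in G &, {morph dfst : x y / (x * y)%g}}.
Proof. exact: divgrM compl cG's. Qed.

Lemma dsndM : {in G &, {morph dsnd : x y / (x * y)%g}}.
Proof. exact: remgrM compl nG'. Qed.

Lemma dfst_id g : g \in G' -> dfst g = g.
Proof. exact: divgr_id. Qed.

Lemma dsnd_id g : g \in <[sigma]>%g -> dsnd g = g.
Proof. by apply: remgr_id; case/complP: compl. Qed.

Lemma dfst_cycle g : g \in <[sigma]>%g -> dfst g = 1%g.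
Proof. by move=> gs; rewrite /dfst /divgr -/(dsnd g) dsnd_id ?mulgV. Qed.

Lemma dsnd_G' g : g \in G' -> dsnd g = 1%g.
Proof. exact: remgr1. Qed.

Lemma dfst1 : dfst 1%g = 1%g. Proof. by rewrite dfst_id. Qed.
Lemma dsnd1 : dsnd 1%g = 1%g. Proof. by rewrite dsnd_G'. Qed.

Lemma dfstV g : g \in G -> dfst g^-1%g = (dfst g)^-1%g.
Proof.
move=> gG; apply/eqP; rewrite eq_sym eq_invg_mul -dfstM ?groupV //.
by rewrite mulgV dfst1.
Qed.

Lemma sub_G' g : g \in G' -> g \in G.
Proof. by apply/subsetP; case/andP: nG'. Qed.

Lemma sub_sigma g : g \in <[sigma]>%g -> g \in G.
Proof. by apply/subsetP; case/dprod_normal2: defG => _ /andP[]. Qed.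

Section Pullback.

Variables (K : fieldType) (n : nat) (rG' : mx_representation K G' n).

Definition pull_mx (g : gT) : 'M[K]_n := rG' (dfst g).

Lemma pull_mx_repr : mx_repr G pull_mx.
Proof.
split=> [|g h gG hG]; first by rewrite /pull_mx dfst1 repr_mx1.
by rewrite /pull_mx dfstM // repr_mxM ?dfst_in.
Qed.

Definition pull_repr := MxRepresentation pull_mx_repr.

Lemma rep_act_pull g u : g \in G -> rep_act pull_repr g u = rep_act rG' (dfst g) u.
Proof.
move=> gG; have E p : poly_act pull_repr g p = poly_act rG' (dfst g) p.
  rewrite /poly_act; congr (_ \mPo _); apply: eq_mktuple => i.
  by apply: eq_bigr => j _; rewrite /= /pull_mx dfstV.
have [a [b [b0 ->]]] := frac_numden u.
apply: etrans (rep_act_frac pull_repr a gG b0) _.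
apply: etrans (esym (rep_act_frac rG' a (dfst_in gG) b0)).
by rewrite !E.
Qed.

End Pullback.

Section CyclicCharacter.

Variables (K : fieldType) (p : nat) (zeta : K).
Hypotheses (sigma_p : #[sigma]%g = p) (zetaP : p.-primitive_root zeta).

Definition cyclic_log (s : gT) : nat :=
  if [pick i : 'I_p | sigma ^+ i == s]%g is Some i then i else 0.

Lemma cyclic_logP s : s \in <[sigma]>%g -> (sigma ^+ cyclic_log s = s)%g.
Proof.
case/cyclePmin => i; rewrite sigma_p => lt ->; rewrite /cyclic_log.
by case: pickP => [j /eqP //|/(_ (Ordinal lt))]; rewrite eqxx.
Qed.

(** The character of G trivial on G' and sending sigma to zeta. *)
Definition chi (g : gT) : K := zeta ^+ cyclic_log (dsnd g).

Lemma chi_pow g i : dsnd g = (sigma ^+ i)%g -> chi g = zeta ^+ i.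
Proof.
move=> E; apply/eqP; rewrite /chi (eq_prim_root_expr zetaP) -sigma_p -eq_expg_mod_order E.
by rewrite cyclic_logP // mem_cycle.
Qed.

Lemma chiM : {in G &, {morph chi : g h / (g * h)%g >-> g * h}}.
Proof.
move=> g h gG hG; rewrite [RHS]/= /chi -exprD; apply: chi_pow.
by rewrite dsndM // expgD !cyclic_logP ?dsnd_in.
Qed.

Lemma chi1 : chi 1%g = 1.
Proof. by rewrite (@chi_pow 1%g 0) ?dsnd1. Qed.

Lemma chi_neq0 g : chi g != 0.
Proof.
apply/expf_neq0/eqP => z0; have := prim_expr_order zetaP.
rewrite z0 expr0n eqn0Ngt (prim_order_gt0 zetaP) => /esym/eqP.
by rewrite oner_eq0.
Qed.

Lemma chi_expp g : chi g ^+ p = 1.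
Proof. by rewrite /chi exprAC (prim_expr_order zetaP) expr1n. Qed.

Lemma chi_eq1 g : g \in G -> chi g = 1 -> dsnd g = 1%g.
Proof.
move=> gG; have [i E] := cycleP _ _ (dsnd_in gG).
rewrite (chi_pow E) E => /eqP; rewrite -(expr0 zeta) (eq_prim_root_expr zetaP).
by rewrite -sigma_p -eq_expg_mod_order expg0 => /eqP.
Qed.

Lemma chi_mx_repr : mx_repr G (fun g => (chi g)%:M : 'M[K]_1).
Proof. by split=> [|g h gG hG]; rewrite ?chi1 // chiM // scalar_mxM. Qed.

Definition chi_repr := MxRepresentation chi_mx_repr.

(** B consists of the elements whose conjugates are algebraic over S and y,
    where S is the copy of F and y spans a copy of the character chi: an
    element trivial on S has trivial component in G', and one trivial on y has
    trivial component in <sigma>. *)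
Lemma ed_le_upper (L : fieldType) (iota : {rmorphism K -> L})
    (act : gT -> {rmorphism L -> L}) (z : L) n (rG' : mx_representation K G' n) d :
  field_action iota G act -> faithful_on G act predT ->
  z \in fixed G act -> infinite_order z ->
  ed_le (@ratfunC K n) G' (rep_act rG') d -> ed_le iota G act d.+1.
Proof.
move=> actP act_f zf zi [F [[cF KF G'F] Ff Fd]].
have Fs : stable_subfield (@ratfunC K n) G (rep_act (pull_repr rG')) F.
  by split=> // g u gG uF; rewrite rep_act_pull //; apply: G'F => //; apply: dfst_in.
have [S [Ss Sd Sf]] := transfer_stable actP act_f zf zi Fs Fd.
have X0 : 'X_ord0 != 0 :> {mpoly K[1]} by rewrite -msupp_eq0 msuppX.
have [phi phi_cov] := covariant_nonvanishing actP act_f zf zi chi_repr X0.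
rewrite mmapX mmap1U => y0; set y := phi ord0 in y0.
have yE g : g \in G -> act g y = iota (chi g^-1%g) * y.
  by move=> gG; rewrite phi_cov // big_ord1 /= mxE eqxx mulr1n.
have [A [[cA KA Acl] SA yA Ad]] := algebraic_hull_add y Sd.
have [B [Bs BA AB]] := stable_core actP cA KA.
exists B; split=> //; last exact: trdeg_leS BA Ad.
move=> g gG gB.
have /(Sf g gG) gF : forall w, w \in S -> act g w = w.
  move=> w wS; apply: gB; apply: AB => h hG; apply: SA; case: Ss => _ _ SG.
  exact: SG.
have dg1 : dfst g = 1%g.
  by apply: Ff => [|u uF]; [apply: dfst_in | rewrite -rep_act_pull // gF].
have /gB : y \in B.
  apply: AB => h hG; rewrite yE //; apply: subfieldM => //; exact: KA.
rewrite yE // -[RHS]mul1r => /(mulIf y0) /eqP.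
rewrite fmorph_eq1 => /eqP /chi_eq1; rewrite groupV => /(_ gG) sg1.
apply/eqP; rewrite -eq_invg1 (dfst_dsnd g^-1%g) sg1 mulg1 dfstV // dg1 invg1.
by [].
Qed.

End CyclicCharacter.

End DirectCyclic.

(** * The field k(t) with t multiplied by a character *)

Section TwistedPolynomialField.

Variables (K k : fieldType) (iota : {rmorphism K -> k}).
Variables (gT : finGroupType) (G : {group gT}) (ak : gT -> {rmorphism k -> k}).
Hypothesis akP : field_action iota G ak.
Variable c : gT -> K.
Hypotheses (c1 : c 1%g = 1) (cM : {in G &, {morph c : g h / (g * h)%g >-> g * h}})
  (c0 : forall g, c g != 0).

Local Notation L := {fraction {poly k}}.

Definition twist_iota : {rmorphism K -> L} := @tofrac _ \o (@polyC k \o iota).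
Definition twist_var : L := ('X : {poly k})%:F.

Definition twist_poly (g : gT) : {rmorphism {poly k} -> {poly k}} :=
  comp_poly (iota (c g) *: 'X) \o map_poly (ak g).

Lemma comp_scaleX_inj (a : k) : a != 0 -> injective (comp_poly (a *: 'X) : {poly k} -> {poly k}).
Proof.
move=> a0; apply: (can_inj (g := comp_poly (a^-1 *: 'X))) => p.
by rewrite -comp_polyA comp_polyZ comp_polyX scalerA divff // scale1r comp_polyXr.
Qed.

Lemma twist_frac_inj g : injective (@tofrac _ \o twist_poly g).
Proof.
move=> p q /= /eqP; rewrite tofrac_eq => /eqP /comp_scaleX_inj.
rewrite fmorph_eq0 => /(_ (c0 g)); exact: map_poly_inj.
Qed.

Definition twist_act (g : gT) : {rmorphism L -> L} :=
  locked (frac_lift (@twist_frac_inj g) : {rmorphism _ -> _}).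

Lemma twist_act_frac g p q : q != 0 ->
  twist_act g (p%:F / q%:F) = (twist_poly g p)%:F / (twist_poly g q)%:F.
Proof. by move=> q0; have := frac_liftE (@twist_frac_inj g) p q0; rewrite /twist_act -lock. Qed.

Lemma twist_actF g p : twist_act g p%:F = (twist_poly g p)%:F.
Proof. by have := frac_liftF (@twist_frac_inj g) p; rewrite /twist_act -lock. Qed.

Lemma twist_polyC g a : twist_poly g a%:P = (ak g a)%:P.
Proof. by rewrite /= map_polyC comp_polyC. Qed.

Lemma twist_polyX g : twist_poly g 'X = iota (c g) *: 'X.
Proof. by rewrite /= map_polyX comp_polyX. Qed.

Lemma twist_poly1 p : twist_poly 1%g p = p.
Proof.
have [ak1 _ _] := akP.
rewrite /= c1 rmorph1 scale1r comp_polyXr; apply/polyP => i.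
by rewrite coef_map; apply: ak1.
Qed.

Lemma twist_polyM g h p : g \in G -> h \in G ->
  twist_poly (g * h)%g p = twist_poly g (twist_poly h p).
Proof.
move=> gG hG; have [_ akM akK] := akP; elim/poly_ind: p => [|p a IH].
  by rewrite !rmorph0.
rewrite ![in LHS]rmorphD ![in LHS]rmorphM ![in RHS]rmorphD ![in RHS]rmorphM.
rewrite -IH !twist_polyC akM // !twist_polyX; congr (_ * _ + _).
rewrite -[iota (c h) *: 'X]mul_polyC [RHS]rmorphM twist_polyC twist_polyX akK // mul_polyC scalerA.
by rewrite cM // rmorphM mulrC.
Qed.

Lemma twist_field_action : field_action twist_iota G twist_act.
Proof.
split=> [z|g h gG hG z|g a gG].
- have [p [q [q0 ->]]] := frac_numden z.
  by apply: etrans (twist_act_frac 1%g p q0) _; rewrite !twist_poly1.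
- have [p [q [q0 ->]]] := frac_numden z.
  have hq0 : twist_poly h q != 0.
    by have := q0; rewrite -!(tofrac_eq0 (R := {poly k})) -!twist_actF fmorph_eq0 tofrac_eq0.
  apply: etrans (twist_act_frac _ p q0) _; apply: esym.
  apply: etrans (congr1 (twist_act g) (twist_act_frac h p q0)) _.
  apply: etrans (twist_act_frac g _ hq0) _.
  by rewrite -!(twist_polyM _ gG hG).
have [_ _ akK] := akP.
by apply: etrans (twist_actF g _) _; rewrite twist_polyC akK.
Qed.

Definition at0 : {rmorphism {poly k} -> k} := horner_eval 0.

(** Reduction modulo t. *)
Definition place_at0 : L -> k -> Prop := frac_place at0.

Lemma place_at0_is_place : is_place twist_iota iota place_at0.
Proof.
apply: (@frac_place_is_place _ _ _ (@polyC k \o iota)) => // a.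
by rewrite /at0 /= /horner_eval hornerC.
Qed.

Lemma at0_twist_poly g p : at0 (twist_poly g p) = ak g (at0 p).
Proof.
by rewrite /at0 /= /horner_eval horner_comp hornerZ hornerX mulr0 -[in LHS](rmorph0 (ak g)) horner_map.
Qed.

Lemma place_at0_equi g u x : g \in G -> place_at0 u x -> place_at0 (twist_act g u) (ak g x).
Proof.
move=> gG [a [b [b0 -> ->]]].
have bn0 : b != 0 by apply: contraNneq b0 => ->; rewrite rmorph0.
exists (twist_poly g a), (twist_poly g b); split.
- by rewrite at0_twist_poly fmorph_eq0.
- exact: (twist_act_frac g a bn0).
- by rewrite !at0_twist_poly fmorph_div.
Qed.

Lemma twist_var_neq0 : twist_var != 0.
Proof. by rewrite /twist_var tofrac_eq0 polyX_eq0. Qed.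

Lemma place_at0_var : place_at0 twist_var 0.
Proof. by have := frac_placeF at0 'X; rewrite /at0 /= /horner_eval hornerX. Qed.

Lemma poly_Xn_unit (p : {poly k}) : p != 0 ->
  exists n q, at0 q != 0 /\ p = 'X ^+ n * q.
Proof.
move=> p0; have [n [q Hq ->]] := multiplicity_XsubC p 0.
by exists n, q; split; [rewrite p0 /= in Hq; exact: Hq | rewrite subr0 mulrC].
Qed.

Lemma twist_var_decomp (z : L) : z != 0 ->
  exists (i : int) (u : L) (x : k), [/\ x != 0, place_at0 u x & z = twist_var ^ i * u].
Proof.
have [p [q [q0 ->]]] := frac_numden z => z0.
have p0 : p != 0.
  by apply: contraNneq z0 => ->; rewrite tofrac0 mul0r.
have [n [p' [p'0 ->]]] := poly_Xn_unit p0; have [m [q' [q'0 ->]]] := poly_Xn_unit q0.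
exists (n%:Z - m%:Z), (p'%:F / q'%:F), (at0 p' / at0 q'); split.
- by rewrite mulf_neq0 ?invr_neq0.
- by exists p', q'.
rewrite expfzDr ?twist_var_neq0 // -exprnN.
rewrite !rmorphM !rmorphXn invfM /= -/twist_var.
by rewrite mulrACA.
Qed.

Lemma twist_act_var g : twist_act g twist_var = twist_iota (c g) * twist_var.
Proof. by apply: etrans (twist_actF g _) _; rewrite twist_polyX -mul_polyC tofracM. Qed.

Lemma twist_act_const g (a : k) : twist_act g (a%:P)%:F = ((ak g a)%:P)%:F.
Proof. by apply: etrans (twist_actF g _) _; rewrite twist_polyC. Qed.

Lemma twist_var_infinite_order m : (0 < m)%N -> infinite_order (twist_var ^+ m).
Proof.
move=> m0 i j /= /eqP.
rewrite -!exprM -!tofracXn tofrac_eq => /eqP /(congr1 (fun q : {poly k} => size q)).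
by rewrite !size_polyXn => -[] /eqP; rewrite eqn_pmul2l // => /eqP.
Qed.

End TwistedPolynomialField.

(** * Residue fields of subfields *)

Section SubfieldExpz.
Variables (L : fieldType) (E : {pred L}) (cE : divring_closed E).
Lemma subfieldXz (j : int) : {in E, forall u, u ^ j \in E}.
Proof. by case: j => n u uE; rewrite /exprz ?subfieldV ?subfieldX //; apply: subfieldX. Qed.
End SubfieldExpz.

Section ResidueField.

Variables (K L k : fieldType) (iL : {rmorphism K -> L}) (ik : {rmorphism K -> k}).
Variable R : L -> k -> Prop.
Hypothesis RP : is_place iL ik R.

Lemma placeXz (j : int) u x : R u x -> x != 0 -> R (u ^ j) (x ^ j).
Proof.
move=> Rux x0; case: j => n; rewrite /exprz; first exact: (placeX RP).
apply: (placeV RP); last exact: expf_neq0.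
exact: (placeX RP).
Qed.

(** Lifts of an independent family of residues stay independent when pi is
    added: divide a relation by the highest power of pi and reduce. *)
Lemma trdeg_le_residue (F : {pred L}) (pi : L) e :
  pi \in F -> pi != 0 -> R pi 0 -> trdeg_le iL F e ->
  (0 < e)%N /\ trdeg_le ik (place_image R F) e.-1.
Proof.
move=> piF pi0 Rpi Fe.
have H m (y : 'I_m -> k) : (forall i, y i \in place_image R F) ->
    alg_independent ik y -> (m < e)%N.
  move=> yF yi; have /fin_all_exists [x xP] : forall i, exists x, x \in F /\ R x (y i).
    by move=> i; have /place_imageP [u uF Ru] := yF i; exists u.
  apply: (Fe m.+1 (fam_rcons x pi)).
    by move=> i; rewrite /fam_rcons; case: unlift => // j; case: (xP j).
  move=> p; rewrite mmap_fam_rcons => p0.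
  apply: (@muni_inj _ _ p 0); rewrite rmorph0; apply/eqP; apply: contraT => mp0.
  (* q is the relation divided by the highest power of its last variable *)
  have [s [q Hq qE]] := multiplicity_XsubC (muni p) 0.
  rewrite mp0 /= in Hq; case/negP: Hq; apply/eqP.
  apply: yi.
  have q0 : (map_poly (mmap iL x) q).[pi] = 0.
    move/eqP: p0; rewrite qE subr0 rmorphM rmorphXn /= map_polyX hornerM hornerXn.
    by rewrite mulf_eq0 expf_eq0 (negPf pi0) andbF orbF => /eqP.
  have : R (map_poly (mmap iL x) q).[pi] (map_poly (mmap ik y) q).[0].
    rewrite !(@horner_coef_wide _ (size q)) ?size_poly //.
    apply: (big_ind2 R) => [|u v u' v' Ru Rv|i _]; first exact: (place00 RP).
      exact: (placeD RP).
    rewrite !coef_map; apply: (placeM RP); last exact: (placeX RP).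
    by apply: (place_mmap RP) => j; case: (xP j).
  rewrite q0 => /(place0 RP) E; rewrite -[RHS]E.
  have := horner_map (mmap ik y) q 0; rewrite rmorph0 => ->.
  by [].
have e0 : (0 < e)%N.
  by apply: (H 0%N (fun=> 0)) => [[]//|]; apply: alg_independent0.
by split=> // m y yF yi; have := H m y yF yi; case: (e) e0.
Qed.

Lemma place_total (t : L) : R t 0 ->
  (forall z : L, z != 0 -> exists (i : int) (u : L) (x : k), [/\ x != 0, R u x & z = t ^ i * u]) ->
  forall z, exists x, R z x \/ R z^-1 x.
Proof.
move=> Rt dec z; have [->|/dec [i [u [x [x0 Ru ->]]]]] := eqVneq z 0.
  by exists 0; left; apply: (place00 RP).
case: i => n; [exists (0 ^+ n * x); left | exists (0 ^+ n.+1 * x^-1); right].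
  by apply: (placeM RP) => //; apply: (placeX RP).
rewrite NegzE -exprnN invfM invrK; apply: (placeM RP); first exact: (placeX RP).
exact: (placeV RP).
Qed.

(** The values of F under the t-adic valuation form a subgroup of the
    integers; pi generates it. *)
Lemma uniformizer (t : L) (F : {pred L}) (y : L) :
  t != 0 -> R t 0 ->
  (forall z : L, z != 0 -> exists (i : int) (u : L) (x : k), [/\ x != 0, R u x & z = t ^ i * u]) ->
  divring_closed F -> y \in F -> y != 0 -> R y 0 ->
  exists pi, [/\ pi \in F, pi != 0, R pi 0 &
    forall z, z \in F -> z != 0 ->
      exists (j : int) (u : L) (x : k), [/\ u \in F, x != 0, R u x & z = pi ^ j * u]].
Proof.
move=> t0 Rt dec cF yF y0 Ry.
pose P n := `[< (0 < n)%N /\ exists (z u : L) (x : k), [/\ z \in F, x != 0, R u x & z = t ^+ n * u] >].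
have exP : exists n, P n.
  have [i [u [x [x0 Ru yE]]]] := dec y y0.
  case: i yE => n yE.
    exists n; apply/asboolP; split; last by exists y, u, x.
    rewrite lt0n; apply: contraNneq x0 => n0; apply/eqP.
    by apply: (place_uniq RP Ru); rewrite n0 expr0z mul1r in yE; rewrite -yE.
  case/eqP: x0; apply: (place_uniq RP Ru).
  have -> : u = t ^+ n.+1 * y by rewrite yE NegzE -exprnN mulVKf // expf_neq0.
  by rewrite -(mulr0 (0 ^+ n.+1)); apply: (placeM RP) => //; apply: (placeX RP).
case: (ex_minnP exP) => e /asboolP [e0 [pi [v [w [piF w0 Rv piE]]]]] emin.
have te0 : t ^+ e != 0 by apply: expf_neq0.
have v0 : v != 0 by apply: contraNneq w0 => v0; apply/eqP/(place0 RP); rewrite -v0.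
have pi0 : pi != 0 by rewrite piE mulf_neq0.
exists pi; split=> //.
  rewrite piE -[0](mul0r w); apply: (placeM RP) => //.
  by have := placeX RP e Rt; rewrite expr0n eqn0Ngt e0.
move=> z zF z0; have [i [u [x [x0 Ru zE]]]] := dec z z0.
pose j := (i %/ e%:Z)%Z.
exists j, (z * pi ^ (- j)), (x * w ^ (- j)).
have zpi : z * pi ^ (- j) = t ^ (i %% e%:Z)%Z * (u * v ^ (- j)).
  rewrite zE piE expfzMl exprnP exprz_exp mulrACA -expfzDr //.
  by congr (t ^ _ * _); rewrite {1}(divz_eq i e%:Z) mulrN mulrC addrAC -/j [e%:Z * j]mulrC subrr add0r.
have zF' : z * pi ^ (- j) \in F by apply: subfieldM => //; apply: subfieldXz.
have xw0 : x * w ^ (- j) != 0 by rewrite mulf_neq0 // expfz_neq0.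
have Ruv : R (u * v ^ (- j)) (x * w ^ (- j)) by apply: (placeM RP) => //; apply: placeXz.
split=> //; last by rewrite mulrC -mulrA -expfzDr // addNr expr0z mulr1.
have : (0 : int) <= (i %% e%:Z)%Z by rewrite modz_ge0 // -lt0n.
have : (i %% e%:Z)%Z < e%:Z by rewrite ltz_pmod.
case E : (i %% e%:Z)%Z zpi => [r|//] zpi lt _.
(* otherwise r would be a smaller positive value *)
have r0 : r = 0%N.
  apply/eqP; rewrite -leqn0 leqNgt; apply/negP => r0.
  have /emin : P r.
    by apply/asboolP; split=> //; exists (z * pi ^ (- j)), (u * v ^ (- j)), (x * w ^ (- j)).
  by rewrite leqNgt; move: lt; rewrite ltz_nat => ->.
by rewrite zpi r0 expr0z mul1r.
Qed.

End ResidueField.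

(** * Inertia and its ramification character *)

Section Inertia.

Variables (K L k : fieldType) (iL : {rmorphism K -> L}) (ik : {rmorphism K -> k}).
Variable R : L -> k -> Prop.
Hypothesis RP : is_place iL ik R.
Variables (gT : finGroupType) (G : {group gT}).
Variables (aL : gT -> {rmorphism L -> L}) (ak : gT -> {rmorphism k -> k}).
Hypotheses (aLP : field_action iL G aL) (akP : field_action ik G ak).
Hypothesis R_equi : forall g u x, g \in G -> R u x -> R (aL g u) (ak g x).
Variable F : {pred L}.
Hypotheses (Fs : stable_subfield iL G aL F) (Ff : faithful_on G aL F).
Variable pi : L.
Hypotheses (piF : pi \in F) (pi0 : pi != 0) (Rpi : R pi 0).
Hypothesis dec : forall z, z \in F -> z != 0 ->
  exists (j : int) (u : L) (x : k), [/\ u \in F, x != 0, R u x & z = pi ^ j * u].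
(** This makes the ramification character invariant under conjugation. *)
Hypothesis roots_of_unity_ground : forall (c : k) n, (0 < n)%N -> c ^+ n = 1 -> exists a, c = ik a.

Let aL1 z : aL 1%g z = z. Proof. by case: aLP. Qed.
Let aLM g h z : g \in G -> h \in G -> aL (g * h)%g z = aL g (aL h z).
Proof. by move=> gG hG; case: aLP => _ ->. Qed.
Let akM g h z : g \in G -> h \in G -> ak (g * h)%g z = ak g (ak h z).
Proof. by move=> gG hG; case: akP => _ ->. Qed.
Let FG g z : g \in G -> z \in F -> aL g z \in F. Proof. by case: Fs => _ _; apply. Qed.

Let kF := place_image R F.

(** g(pi) has residue 0, hence positive valuation, which is at least that of
    pi. *)
Lemma ramification_ex g : g \in G -> exists v, R (aL g pi / pi) v.
Proof.
move=> gG; have Rg : R (aL g pi) 0 by rewrite -(rmorph0 (ak g)); apply: R_equi.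
have gpi0 : aL g pi != 0 by rewrite fmorph_eq0.
have [j [u [x [uF x0 Ru E]]]] := dec (FG gG piF) gpi0.
case: j E => [[|n]|n] E.
- case/eqP: x0; apply: (place_uniq RP Ru).
  by rewrite expr0z mul1r in E; rewrite -E.
- exists (0 ^+ n * x).
  have -> : aL g pi / pi = pi ^+ n * u by rewrite E -exprnP exprSr mulrAC mulfK.
  by apply: (placeM RP) => //; apply: (placeX RP).
- case/eqP: x0; apply: (place_uniq RP Ru).
  have -> : u = pi ^+ n.+1 * aL g pi by rewrite E NegzE -exprnN mulVKf // expf_neq0.
  by rewrite -(mulr0 (0 ^+ n.+1)); apply: (placeM RP) => //; apply: (placeX RP).
Qed.

Lemma ramification_fun : exists lam : gT -> k, forall g, g \in G -> R (aL g pi / pi) (lam g).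
Proof.
have /choice [lam lamP] : forall g, exists v, g \in G -> R (aL g pi / pi) v.
  move=> g; case: (boolP (g \in G)) => [/ramification_ex [v Rv]|_]; first by exists v.
  by exists 0.
by exists lam.
Qed.

(** The inertia group of F, as the kernel of the action on its residue field. *)
Definition res_inertia : {set gT} := [set g in G | `[< forall w, w \in kF -> ak g w = w >]].

Lemma res_inertiaP g : reflect (g \in G /\ forall w, w \in kF -> ak g w = w) (g \in res_inertia).
Proof. by rewrite inE; apply: (iffP andP) => -[gG /asboolP]. Qed.

Lemma res_inertia_group_set : group_set res_inertia.
Proof.
apply/group_setP; split=> [|g h /res_inertiaP [gG gk] /res_inertiaP [hG hk]]; apply/res_inertiaP.
  by split=> // w _; case: akP.
by split=> [|w wk]; [apply: groupM | rewrite akM // hk // gk].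
Qed.
Canonical res_inertia_group := Group res_inertia_group_set.

Lemma res_inertia_sub : res_inertia \subset G.
Proof. by apply/subsetP => g /res_inertiaP []. Qed.

Lemma residue_field_stable g w : g \in G -> w \in kF -> ak g w \in kF.
Proof. by have [_ _] := stable_place_image RP R_equi Fs; apply. Qed.

Lemma res_inertiaJ g h : g \in res_inertia -> h \in G -> (h * g * h^-1)%g \in res_inertia.
Proof.
case/res_inertiaP => gG gk hG; apply/res_inertiaP; split=> [|w wk]; first by rewrite !groupM ?groupV.
rewrite akM ?groupM ?groupV // akM // gk ?residue_field_stable ?groupV // -akM ?groupV // mulgV.
by case: akP.
Qed.

Section RamificationCharacter.

Variable lam : gT -> k.
Hypothesis lamP : forall g, g \in G -> R (aL g pi / pi) (lam g).

(** On the inertia group this says that lam is a homomorphism. *)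
Lemma lam_cocycle g h : g \in G -> h \in G -> lam (g * h)%g = ak g (lam h) * lam g.
Proof.
move=> gG hG; apply: (place_uniq RP (lamP (groupM gG hG))).
have -> : aL (g * h)%g pi / pi = aL g (aL h pi / pi) * (aL g pi / pi).
  by rewrite aLM // fmorph_div mulrA divfK // fmorph_eq0.
by apply: (placeM RP); [apply/R_equi/lamP | apply: lamP].
Qed.

Lemma lam1 : lam 1%g = 1.
Proof.
by apply: (place_uniq RP (lamP (group1 G))); rewrite aL1 divff //; apply: (place11 RP).
Qed.

Lemma lam_residue_field g : g \in G -> lam g \in kF.
Proof.
move=> gG; apply/place_imageP; exists (aL g pi / pi); last exact: lamP.
by case: Fs => cF _ _; apply: subfield_div => //; apply: FG.
Qed.

Lemma lamM g h : g \in res_inertia -> h \in G -> lam (g * h)%g = lam h * lam g.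
Proof. by case/res_inertiaP => gG gk hG; rewrite lam_cocycle // gk // lam_residue_field. Qed.

Lemma lamX g n : g \in res_inertia -> lam (g ^+ n)%g = lam g ^+ n.
Proof.
move=> gI; elim: n => [|n IH]; first by rewrite expg0 expr0 lam1.
by rewrite expgS lamM ?groupX ?(subsetP res_inertia_sub) // IH exprSr.
Qed.

Lemma lam_ground g : g \in res_inertia -> exists a, lam g = ik a.
Proof.
move=> gI; apply: (roots_of_unity_ground (order_gt0 g)).
by rewrite -lamX // expg_order lam1.
Qed.

(** The cocycle identity yields h(lam g), which is lam g as the latter is a
    root of unity, hence in K. *)
Lemma lamJ g h : g \in res_inertia -> h \in G -> lam (h * g * h^-1)%g = lam g.
Proof.
move=> gI hG; have gG := subsetP res_inertia_sub _ gI.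
have [a aE] := lam_ground gI; have hV : (h^-1)%g \in G by rewrite groupV.
rewrite -mulgA lam_cocycle ?groupM // lamM // rmorphM aE.
have -> : ak h (ik a) = ik a by case: akP => _ _; apply.
by rewrite mulrAC -lam_cocycle // mulgV lam1 mul1r.
Qed.

Definition wild : {set gT} := [set g in res_inertia | lam g == 1].

Lemma wildP g : reflect (g \in res_inertia /\ lam g = 1) (g \in wild).
Proof. by rewrite [X in reflect _ X]in_set; apply: (iffP andP) => -[gI /eqP]. Qed.

Lemma wild_group_set : group_set wild.
Proof.
apply/group_setP; split; first by apply/wildP; split; [apply: group1 | apply: lam1].
move=> g h /wildP[gI g1] /wildP[hI h1]; apply/wildP; split; first exact: groupM.
by rewrite lamM ?(subsetP res_inertia_sub) // g1 h1 mulr1.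
Qed.
Canonical wild_group := Group wild_group_set.

Lemma wild_normal : (wild <| G)%g.
Proof.
apply/andP; split; first by apply/subsetP => g /wildP[/(subsetP res_inertia_sub)].
apply/subsetP => h hG; rewrite inE; apply/subsetP => _ /imsetP [g /wildP[gI g1] ->].
have hV : (h^-1)%g \in G by rewrite groupV.
have -> : (g ^ h)%g = (h^-1 * g * h^-1^-1)%g by rewrite conjgE invgK mulgA.
by apply/wildP; rewrite lamJ // g1; split=> //; apply: res_inertiaJ.
Qed.

(** Write z as a power of pi times a unit u: the residue of g(pi)/pi is 1 and
    g fixes the residue of u. *)
Lemma wild_residue g z : g \in wild -> z \in F -> z != 0 -> R (aL g z / z) 1.
Proof.
move=> /wildP[gI g1] zF z0; have /res_inertiaP [gG gk] := gI.
have [j [u [x [uF x0 Ru ->]]]] := dec zF z0.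
have u0 : u != 0 by apply: contraNneq x0 => u0; apply/eqP/(place0 RP); rewrite -u0.
have -> : aL g (pi ^ j * u) / (pi ^ j * u) = (aL g pi / pi) ^ j * (aL g u / u).
  by rewrite rmorphM fmorphXz invfM mulrACA expfzMl exprz_inv invr_expz.
have -> : 1 = 1 ^ j * (ak g x / x) :> k.
  rewrite gk; last by apply/place_imageP; exists u.
  by rewrite divff // mulr1 exp1rz.
apply: (placeM RP); first by apply: (placeXz RP) => //; [rewrite -g1; apply: lamP | apply: oner_neq0].
by apply: (placeM RP); [apply: R_equi | apply: (placeV RP)].
Qed.

(** Tameness.  If g moved z in F, then y = g(z) - z would satisfy
    y + g(y) + ... + g^(q-1)(y) = 0; dividing by y and taking residues gives
    q = 0 in k by [wild_residue]. *)
Lemma wild_order g q : g \in wild -> prime q -> #[g]%g = q -> q \in [pchar k].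
Proof.
move=> gW q_pr gq; rewrite inE q_pr /=; apply: contraT => qk.
have /res_inertiaP [gG _] : g \in res_inertia by case/wildP: gW.
suff g1 : g = 1%g by move: gq q_pr; rewrite g1 order1 => <-.
apply: Ff => // z zF; apply/eqP; rewrite -subr_eq0; apply: contraT => y0.
set y := aL g z - z in y0.
have [cF _ _] := Fs.
have yF : y \in F by apply: subfieldB => //; apply: FG.
have Rn n : R (aL (g ^+ n)%g y / y) 1.
  elim: n => [|n IH]; first by rewrite expg0 aL1 divff //; apply: (place11 RP).
  have gnG : (g ^+ n)%g \in G by apply: groupX.
  have gny0 : aL (g ^+ n)%g y != 0 by rewrite fmorph_eq0.
  have -> : aL (g ^+ n.+1)%g y / y = (aL g (aL (g ^+ n)%g y) / aL (g ^+ n)%g y) * (aL (g ^+ n)%g y / y).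
    by rewrite expgS aLM // mulrA divfK.
  by rewrite -[1]mulr1; apply: (placeM RP) => //; apply: wild_residue => //; apply: FG.
have sum0 : \sum_(i < q) aL (g ^+ i)%g y = 0.
  transitivity (\sum_(0 <= i < q) (aL (g ^+ i.+1)%g z - aL (g ^+ i)%g z)).
    rewrite big_mkord; apply: eq_bigr => i _.
    by rewrite /y rmorphB expgSr aLM // groupX.
  by rewrite telescope_sumr // expg0 -gq expg_order subrr.
case/negP: qk; apply/eqP; apply: (place0 RP).
have <- : \sum_(i < q) aL (g ^+ i)%g y / y = 0 by rewrite -mulr_suml sum0 mul0r.
have -> : q%:R = \sum_(i < q) 1 :> k by rewrite sumr_const card_ord.
apply: (big_ind2 R); [exact: (place00 RP) | | by move=> i _; apply: Rn].
by move=> *; apply: (placeD RP).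
Qed.

Lemma lam_inj : wild = 1%g -> {in res_inertia &, injective lam}.
Proof.
move=> W1 g h gI hI E; have hG := subsetP res_inertia_sub _ hI.
have : (g * h^-1)%g \in wild.
  have hV : (h^-1)%g \in res_inertia by rewrite groupV.
  apply/wildP; split; first exact: groupM.
  by rewrite lamM ?groupV // E -lamM ?groupV // mulgV lam1.
by rewrite W1 => /set1gP /eqP; rewrite -eq_mulgV1 => /eqP.
Qed.

(** Conjugate elements have the same image under the injective map lam. *)
Lemma res_inertia_central : wild = 1%g -> (res_inertia \subset 'C(G))%g.
Proof.
move=> W1; apply/subsetP => g gI; apply/centP => h hG.
have := lam_inj W1 (res_inertiaJ gI hG) gI (lamJ gI hG).
by move/(congr1 (mulg^~ h)); rewrite /= mulgKV => /esym.
Qed.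

End RamificationCharacter.

Lemma res_inertia_character :
  (forall W : {group gT}, (W <| G)%g ->
    (forall g q, g \in W -> prime q -> #[g]%g = q -> q \in [pchar k]) -> (W :=: 1)%g) ->
  (res_inertia \subset 'C(G))%g /\ exists mu : gT -> K,
    {in res_inertia &, injective mu} /\
    (forall g m, g \in res_inertia -> mu (g ^+ m)%g = mu g ^+ m).
Proof.
move=> wild_triv; have [lam lamP] := ramification_fun.
have W1 : wild lam = 1%g.
  exact: (wild_triv (wild_group lamP) (wild_normal lamP) (wild_order lamP)).
split; first exact: res_inertia_central lamP W1.
have /choice [mu muP] : forall g, exists a, g \in res_inertia -> lam g = ik a.
  move=> g; have [/(lam_ground lamP) [a ->]|_] := boolP (g \in res_inertia); first by exists a.
  by exists 0.
exists mu; split=> [g h gI hI E|g m gI].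
  by apply: (lam_inj lamP W1 gI hI); rewrite !muP // E.
apply: (fmorph_inj ik); rewrite rmorphXn /= -!muP //; last exact: groupX.
exact: lamX.
Qed.

End Inertia.

(** * Roots of unity in a field of rational functions *)

Section RootsOfUnity.

Variables (K : fieldType) (n : nat).

Lemma mleadc_expM (a b : {mpoly K[n]}) j m : a != 0 -> b != 0 -> mlead a = mlead b ->
  (a ^+ j * b ^+ m)@_(mlead b *+ (j + m))%MM = mleadc a ^+ j * mleadc b ^+ m.
Proof.
move=> a0 b0 E; have -> : (mlead b *+ (j + m) = mlead (a ^+ j) + mlead (b ^+ m))%MM.
  rewrite (mleadX _ a0) (mleadX _ b0) E; apply/mnmP => i.
  by rewrite mnmDE !mulmnE mulnDr.
by rewrite mleadcM (mleadX _ a0) (mleadX _ b0) !mleadcX.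
Qed.

(** If a^m = b^m then a and b have the same leading monomial; let c0 be the
    quotient of their leading coefficients.  Were a/b different from c0, it
    would be a root of the part q of X^m - 1 prime to X - c0; in this equation,
    multiplied by a power of b, all terms have the same leading monomial, so
    that looking at leading coefficients gives q(c0) = 0. *)
Lemma ratfun_unity_root (c : {fraction {mpoly K[n]}}) m : (0 < m)%N -> c ^+ m = 1 ->
  exists a, c = @ratfunC K n a.
Proof.
move=> m0 cm1; have [a [b [b0 cE]]] := frac_numden c.
have bF0 : b%:F != 0 by rewrite tofrac_eq0.
have aF : a%:F = c * b%:F by rewrite cE divfK.
have abm : a ^+ m = b ^+ m.
  by apply/eqP; rewrite -tofrac_eq !tofracXn aF exprMn cm1 mul1r.
have a0 : a != 0.
  by move: (expf_neq0 m b0); rewrite -abm expf_eq0 m0.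
have lE : mlead a = mlead b.
  have := congr1 (@mlead _ _) abm; rewrite !mleadX // => /mnmP E; apply/mnmP => i.
  by have /eqP := E i; rewrite !mulmnE eqn_pmul2r // => /eqP.
have lb0 : mleadc b != 0 by rewrite mleadc_eq0.
pose c0 := mleadc a / mleadc b.
exists c0; apply/eqP; rewrite -subr_eq0; apply: contraT => cc0.
pose Q : {poly K} := 'X^m - 1.
have Q0 : Q != 0 by rewrite -size_poly_eq0 size_XnsubC.
have [s [q Hq QE]] := multiplicity_XsubC Q c0.
rewrite Q0 /= in Hq.
pose mp := map_poly (@ratfunC K n).
have mq0 : (mp q).[c] = 0.
  have : (mp Q).[c] = 0.
    by rewrite /mp rmorphB rmorph1 /= map_polyXn hornerD hornerN hornerXn hornerC cm1 subrr.
  rewrite QE /mp rmorphM rmorphXn /= rmorphB /= map_polyX map_polyC hornerM horner_exp.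
  rewrite hornerD hornerN hornerX hornerC => /eqP.
  by rewrite mulf_eq0 expf_eq0 (negPf cc0) andbF orbF => /eqP.
pose r := (size q).-1.
pose P : {mpoly K[n]} := \sum_(i < size q) q`_i *: (a ^+ i * b ^+ (r - i)).
have ir (i : 'I_(size q)) : (i + (r - i) = r)%N.
  by rewrite subnKC // /r; case: (size q) i => [|sz] i; [case: i | rewrite -ltnS].
have termE (i : 'I_(size q)) : (q`_i *: (a ^+ i * b ^+ (r - i)))%:F =
    b%:F ^+ r * ((@ratfunC K n q`_i) * c ^+ i).
  rewrite -mul_mpolyC !tofracM !tofracXn aF -/(ratfunC n q`_i) exprMn -[in RHS](ir i) exprD.
  by rewrite [RHS]mulrC -!mulrA.
have P0 : P = 0.
  apply/eqP; rewrite -tofrac_eq0; apply/eqP.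
  rewrite -[RHS](mulr0 (b%:F ^+ r)) -mq0 horner_coef size_map_poly mulr_sumr rmorph_sum.
  by apply: eq_bigr => i _; rewrite coef_map; apply: termE.
case/negP: Hq; rewrite /root -(mulrI_eq0 _ (mulfI (expf_neq0 r lb0))).
have := congr1 (mcoeff (mlead b *+ r)%MM) P0; rewrite mcoeff0 => E.
rewrite -[0]E horner_coef mulr_sumr raddf_sum /=; apply/eqP/eq_bigr => i _.
have := mleadc_expM i (r - i) a0 b0 lE; rewrite mcoeffZ ir => ->.
have -> : mleadc b ^+ r = mleadc b ^+ i * mleadc b ^+ (r - i) by rewrite -exprD ir.
rewrite [LHS]mulrCA; congr (_ * _); rewrite [LHS]mulrC mulrA /c0 expr_div_n.
by rewrite divfK // expf_neq0.
Qed.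

End RootsOfUnity.

Lemma prime_order_primitive (K : fieldType) (q : nat) (a : K) :
  prime q -> a ^+ q = 1 -> a != 1 -> q.-primitive_root a.
Proof.
move=> q_pr aq a1; have [m ma mq] := prim_order_exists (prime_gt0 q_pr) aq.
case/primeP: q_pr => _ /(_ m mq) /orP[/eqP m1|/eqP <- //].
by case/eqP: a1; have := prim_expr_order ma; rewrite m1 expr1.
Qed.

(** * The lower bound *)

Section LowerBound.

Variables (K : fieldType) (p : nat) (gT : finGroupType) (G G' : {group gT}) (sigma : gT).
Hypothesis p_prime : prime p.
Hypothesis defG : (G' \x <[sigma]> = G)%g.
Hypothesis charK : [pchar K] =i pred0 \/
  exists2 l : nat, l \in [pchar K] &
    forall N : {group gT}, (N <| G)%g -> (l.-group N)%g -> (N :=: 1)%g.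
Hypothesis ord_sigma : #[sigma]%g = p.
Variable zeta : K.
Hypothesis zetaP : p.-primitive_root zeta.
Hypothesis zeta_p' : forall p' : nat, prime p' -> (p' %| #|'Z(G')%g|)%N -> p' != p ->
  ~ has_primitive_root K p'.

Lemma normal_pchar_trivial (W : {group gT}) :
  (W <| G)%g -> (forall g q, g \in W -> prime q -> #[g]%g = q -> q \in [pchar K]) ->
  (W :=: 1)%g.
Proof.
move=> nW Wq; case: charK => [char0|[l lK normal_l]].
  apply/eqP; rewrite trivg_card1; apply: contraT => W1.
  have Wgt1 : (1 < #|W|)%N by have := cardG_gt0 W; case: #|W| W1 => [|[|]].
  have [g gW gq] := Cauchy (pdiv_prime Wgt1) (pdiv_dvd _).
  by have := Wq g _ gW (pdiv_prime Wgt1) gq; rewrite char0.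
apply: (normal_l W nW); apply/pgroupP => q q_pr /(Cauchy q_pr) [g gW gq].
have := Wq g q gW q_pr gq; rewrite (pcharf_eq lK); exact.
Qed.

(** A nontrivial element may be taken of prime order q, central in G'.  Its
    image is a primitive q-th root of unity of K, so q = p, and then it is a
    power of mu sigma. *)
Lemma central_inertia_disjoint (I : {group gT}) (mu : gT -> K) :
  (I \subset 'C(G))%g -> sigma \in I -> {in I &, injective mu} ->
  (forall g m, g \in I -> mu (g ^+ m)%g = mu g ^+ m) ->
  forall g, g \in I -> g \in G' -> g = 1%g.
Proof.
move=> Icen sI mu_inj muX g gI gG'; apply/set1gP.
have mu1 : mu 1%g = 1 by have := muX 1%g 0%N (group1 I); rewrite expg0 expr0.
have prim h q : h \in I -> prime q -> #[h]%g = q -> q.-primitive_root (mu h).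
  move=> hI q_pr hq; apply: prime_order_primitive => //.
    by rewrite -muX // -hq expg_order.
  apply: contraTneq q_pr => E; rewrite -hq.
  by rewrite (mu_inj h 1%g hI (group1 I)) ?order1 // mu1.
have gIG' : g \in (I :&: G')%G by rewrite inE gI.
suff <- : (I :&: G' = 1)%g by [].
apply/eqP; rewrite trivg_card1; apply: contraT => W1.
have Wgt1 : (1 < #|(I :&: G')%g|)%N.
  by have := cardG_gt0 (I :&: G')%G; case: #|_| W1 => [|[|]].
have q_pr := pdiv_prime Wgt1; set q := pdiv _ in q_pr.
have [h /setIP[hI hG'] hq] := Cauchy (G := (I :&: G')%G) q_pr (pdiv_dvd _).
have muh := prim h q hI q_pr hq.
have hZ : (h \in 'Z(G'))%g.
  apply/centerP; split=> // u uG'; apply: (centP (subsetP Icen _ hI)).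
  exact: (sub_G' defG).
have [qp|qp] := eqVneq q p; last first.
  case: (zeta_p' q_pr _ qp); last by exists (mu h).
  by rewrite -hq; apply: order_dvdG.
have mus := prim sigma p sI p_prime ord_sigma.
have muhp : mu h ^+ p = 1 by rewrite -qp (prim_expr_order muh).
have [i E] := prim_rootP mus muhp.
have hs : h = (sigma ^+ i)%g by apply: mu_inj; rewrite ?groupX // muX.
have : h \in (G' :&: <[sigma]>)%g by rewrite inE hG' hs mem_cycle.
have [_ _ _ ->] := dprodP defG => /set1gP h1.
by move: hq q_pr; rewrite h1 order1 => <-.
Qed.

(** Some x in F on which the place is defined is moved by sigma; the residue
    of sigma(x) - x is 0, so the place is nontrivial on F. *)
Lemma residue_descent (L k : fieldType) (iL : {rmorphism K -> L}) (ik : {rmorphism K -> k})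
    (R : L -> k -> Prop) (aL : gT -> {rmorphism L -> L}) (ak : gT -> {rmorphism k -> k})
    (t : L) (F : {pred L}) e :
  is_place iL ik R -> field_action iL G aL -> field_action ik G ak ->
  (forall g u x, g \in G -> R u x -> R (aL g u) (ak g x)) ->
  t != 0 -> R t 0 ->
  (forall z : L, z != 0 -> exists (i : int) (u : L) (x : k), [/\ x != 0, R u x & z = t ^ i * u]) ->
  (forall (c : k) n, (0 < n)%N -> c ^+ n = 1 -> exists a, c = ik a) ->
  (forall u, ak sigma u = u) ->
  stable_subfield iL G aL F -> faithful_on G aL F -> trdeg_le iL F e ->
  (0 < e)%N /\ ed_le ik G' ak e.-1.
Proof.
move=> RP aLP akP R_equi t0 Rt dec unity ak_s Fs Ff Fe.
have [cF KF FG] := Fs.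
have sG : sigma \in G by apply: (sub_sigma defG); apply: cycle_id.
have s1 : sigma != 1%g by rewrite -order_gt1 ord_sigma prime_gt1.
have [x0 x0F x0n] : exists2 x, x \in F & aL sigma x != x.
  apply: contrapT => H; case/eqP: s1; apply: Ff => // z zF.
  by apply/eqP; apply: contraT => zn; case: H; exists z.
have [x [xF xn [w Rx]]] : exists x, [/\ x \in F, aL sigma x != x & exists w, R x w].
  have [w [Rx|Rx]] := place_total RP Rt dec x0; first by exists x0; split=> //; exists w.
  exists x0^-1; split; [exact: subfieldV | | by exists w].
  by rewrite fmorphV (inj_eq invr_inj).
pose y := aL sigma x - x.
have yF : y \in F by apply: subfieldB => //; apply: FG.
have y0 : y != 0 by rewrite subr_eq0.
have Ry : R y 0.
  by rewrite -(subrr w) -{1}(ak_s w); apply: (placeB RP) => //; apply: R_equi.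
have [pi [piF pi0 Rpi Fdec]] := uniformizer RP t0 Rt dec cF yF y0 Ry.
have [e0 kFe] := trdeg_le_residue RP piF pi0 Rpi Fe.
split=> //; exists (place_image R F).
have [ckF KkF GkF] := stable_place_image RP R_equi Fs.
split=> //.
  by split=> // g u gG' ukF; apply: GkF => //; apply: (sub_G' defG).
have pcharE : [pchar k] =i [pchar K] by exact: (fmorph_pchar ik).
have wild_triv (W : {group gT}) : (W <| G)%g ->
    (forall g q, g \in W -> prime q -> #[g]%g = q -> q \in [pchar k]) -> (W :=: 1)%g.
  move=> nW Wq; apply: normal_pchar_trivial => // g q gW q_pr gq.
  by rewrite -pcharE; apply: Wq gq.
have [Icentral [mu [mu_inj muX]]] :=
  res_inertia_character RP aLP akP R_equi Fs Ff piF pi0 Rpi Fdec unity wild_triv.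
pose I : {group gT} := res_inertia_group R akP F.
have sI : sigma \in I by apply/res_inertiaP; split=> // u _; apply: ak_s.
move=> g gG' gfix; have gI : g \in I.
  by apply/res_inertiaP; split=> [|u ukF]; [apply: (sub_G' defG) | apply: gfix].
exact: (central_inertia_disjoint Icentral sI mu_inj muX gI gG').
Qed.

(** An application of [residue_descent] to k(t) with k = K(V'). *)
Lemma ed_le_lower n (rG : mx_representation K G n) n' (rG' : mx_representation K G' n') e :
  mx_faithful rG' -> ed_le (@ratfunC K n) G (rep_act rG) e ->
  (0 < e)%N /\ ed_le (@ratfunC K n') G' (rep_act rG') e.-1.
Proof.
move=> f' edG.
pose k := {fraction {mpoly K[n']}}; pose ik : {rmorphism K -> k} := @ratfunC K n'.
pose rP := pull_repr defG rG'; pose ak := rep_act rP.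
have akP : field_action ik G ak := rep_act_field_action rP.
pose c := chi G' sigma p zeta.
have c1 : c 1%g = 1 := chi1 G' ord_sigma zetaP.
have cM : {in G &, {morph c : g h / (g * h)%g >-> g * h}} := chiM defG ord_sigma zetaP.
have c0 : forall g, c g != 0 := chi_neq0 G' sigma zetaP.
pose L := {fraction {poly k}}; pose iL : {rmorphism K -> L} := twist_iota ik.
pose aL := twist_act ik ak c0.
have aLP : field_action iL G aL := twist_field_action akP c1 cM c0.
pose t : L := twist_var k.
have aLt g : aL g t = iL (c g) * t := twist_act_var ik ak c0 g.
have aLC g (a : k) : aL g (a%:P)%:F = ((ak g a)%:P)%:F := twist_act_const ik ak c0 g a.
have t0 : t != 0 := twist_var_neq0 k.
have ak_pull g u : g \in G -> ak g u = rep_act rG' (dfst G' sigma g) u.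
  exact: rep_act_pull.
have aLf : faithful_on G aL predT.
  move=> g gG gL; rewrite (dfst_dsnd G' sigma g).
  have -> : dsnd G' sigma g = 1%g.
    apply: (chi_eq1 defG ord_sigma zetaP gG); have := gL t isT.
    by rewrite aLt -[RHS]mul1r => /(mulIf t0) /eqP; rewrite fmorph_eq1 => /eqP.
  rewrite mulg1; apply: (rep_act_faithful f' (dfst_in defG gG)) => u _.
  apply: etrans (esym (ak_pull _ u gG)) _; have := gL (u%:P)%:F isT.
  by rewrite aLC => /eqP; rewrite tofrac_eq => /eqP /polyC_inj.
have tpfix : t ^+ p \in fixed G aL.
  apply/fixedP => g gG; rewrite rmorphXn /= aLt exprMn -rmorphXn.
  by rewrite /c chi_expp // rmorph1 mul1r.
have tpinf : infinite_order (t ^+ p) := twist_var_infinite_order (prime_gt0 p_prime).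
have [F [Fs Ff Fe]] := ed_le_transfer aLP aLf tpfix tpinf edG.
have R_equi g u x : g \in G -> place_at0 u x -> place_at0 (aL g u) (ak g x).
  exact: place_at0_equi.
have ak_s u : ak sigma u = u.
  have [act1 _ _] := rep_act_field_action rG'.
  apply: etrans (ak_pull _ u _) _; first exact: (sub_sigma defG (cycle_id _)).
  by rewrite (dfst_cycle defG (cycle_id _)); apply: act1.
have [e0 ed'] := residue_descent (place_at0_is_place ik) aLP akP R_equi t0
  (place_at0_var k) (@twist_var_decomp k) (@ratfun_unity_root K n') ak_s Fs Ff Fe.
split; first exact: e0.
apply: (ed_le_eq_act _ ed') => g u gG'.
apply: etrans (ak_pull _ u (sub_G' defG gG')) _.
have -> : dfst G' sigma g = g := dfst_id sigma gG'.
exact: erefl.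
Qed.

End LowerBound.

Lemma is_ed_repr_min (K : fieldType) (gT : finGroupType) (H : {group gT}) n
    (rH : mx_representation K H n) d :
  mx_faithful rH -> ed_le (@ratfunC K n) H (rep_act rH) d ->
  (forall e, ed_le (@ratfunC K n) H (rep_act rH) e -> (d <= e)%N) ->
  is_ed_repr rH d.
Proof.
move=> ff Hd dmin; rewrite /is_ed_repr fixed_fieldE.
have := is_ed_fixed (rep_act_field_action rH) (rep_act_faithful ff) Hd dmin; apply.
Qed.

Local Close Scope ring_scope.
Local Open Scope group_scope.

Theorem theorem4p6 (K : fieldType) (p : nat) (gT : finGroupType)
    (G G' : {group gT}) (sigma : gT)
    (p_prime : prime p)
    (defG : G' \x <[sigma]> = G)
    (charK : [pchar K]%R =i pred0 \/
       exists2 l : nat, l \in [pchar K]%R &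
         forall N : {group gT}, N <| G -> l.-group N -> N :=: 1)
    (ord_sigma : #[sigma] = p)
    (zeta_p : has_primitive_root K p)
    (zeta_p' : forall p' : nat, prime p' -> p' %| #|'Z(G')| -> p' != p ->
       ~ has_primitive_root K p') :
  exists d : nat, is_ed_group K G' d /\ is_ed_group K G d.+1.
Proof.
have [zeta zetaP] := zeta_p.
pose r0 := regular_repr K G'; have f0 : mx_faithful r0 := regular_mx_faithful K G'.
pose P d := `[< ed_le (@ratfunC K _) G' (rep_act r0) d >].
have exP : exists d, P d by exists #|G'|; apply/asboolP; apply: ratfun_ed_le.
case: (ex_minnP exP) => d /asboolP Pd dmin; exists d; split=> n r fr.
  apply: is_ed_repr_min => // [|e re]; first exact: ed_le_repr_indep Pd.
  by apply: dmin; apply/asboolP; apply: ed_le_repr_indep re.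
apply: is_ed_repr_min => // [|e re].
  case: n r fr => [|n] r fr; first exact: ed_le_mon (leq0n _) (ratfun_ed_le fr).
  have [z zf zi] := ratfun_fixed_infinite r ord0.
  have := ed_le_upper defG ord_sigma zetaP (rep_act_field_action r)
    (rep_act_faithful fr) zf zi Pd.
  exact.
have [e0 re'] := ed_le_lower p_prime defG charK ord_sigma zetaP zeta_p' f0 re.
by rewrite -(prednK e0) ltnS; apply: dmin; apply/asboolP.
Qed.
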